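(* Let $\mathcal{L}$ be a Davies generator in canonical form for the Hamiltonian $H$ and inverse temperature $\beta$, with weights $w_\alpha$, coupling operators $S^\alpha$ and filter functions $G^\alpha$, and let $\sigma=e^{-\beta H}/\mathrm{Tr}(e^{-\beta H})$ be the Gibbs state. Assume that all coupling operators $S^\alpha$ are reflections and all filter functions $G^\alpha$ satisfy $G^\alpha(\omega)\le 1$. Then there exists a corresponding walk unitary $W(\mathcal{L})$ such that its unique eigenvector with eigenphase $0$ is the purification $|\sigma^{1/2}\rangle=(\sigma^{1/2}\otimes I)|\Omega\rangle$ of the Gibbs state $\sigma$, where $|\Omega\rangle=\sum_x|x\rangle\otimes|x\rangle$, and its phase gap is quadratically larger than the spectral gap of the Davies generator $\mathcal{L}$. It can be obtained by standard methods for spectral gap amplification applied to the block encoding of the vectorized quantum discriminate matrix $\mathcal{Q}$ of $\mathcal{L}$. The block encoding can be implemented exactly provided that we can determine the energies of the Hamiltonian $H$.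
   Context: Hamiltonian. $H=\sum_{k=1}^m\varepsilon_k\Pi_k$ on $\mathbb{C}^d$, with distinct eigenvalues $\varepsilon_k\in[0,1]$ and eigenprojectors $\Pi_k$. Its Bohr frequencies are the differences $\varepsilon_k-\varepsilon_\ell$. Davies generator in canonical form. $$\mathcal{L}(\rho)=\sum_\alpha w_\alpha\sum_\omega G^\alpha(\omega)\Big(S^\alpha(\omega)\rho S^\alpha(\omega)^\dagger-\tfrac12\{S^\alpha(\omega)^\dagger S^\alpha(\omega),\rho\}\Big),$$ a convex combination over $\alpha$, where the coupling operators $S^\alpha$ are hermitian, $\omega$ runs over all different Bohr frequencies of $H$, and the jump operators are $S^\alpha(\omega)=\sum_{(k,\ell):\,\varepsilon_k-\varepsilon_\ell=\omega}\Pi_kS^\alpha\Pi_\ell$. They satisfy $S^\alpha(\omega)=S^\alpha(-\omega)^\dagger$ and $\sigma S^\alpha(\omega)\sigma^{-1}=e^{-\beta\omega}S^\alpha(\omega)$, and the filter functions satisfy $G^\alpha(\omega)\ge 0$ and $G^\alpha(\omega)=e^{\beta\omega}G^\alpha(-\omega)$. The operator norm of $\mathcal{L}$ is assumed to satisfy $\|\mathcal{L}\|\le1$. A reflection is a hermitian unitary. Vectorized quantum discriminate. The matrix on $\mathbb{C}^d\otimes\mathbb{C}^d$ $$\mathcal{Q}=I\otimes I+\sum_\alpha w_\alpha\sum_\omega\Big[\sqrt{G^\alpha(\omega)G^\alpha(-\omega)}\,S^\alpha(\omega)\otimes\bar S^\alpha(\omega)-\tfrac{G^\alpha(\omega)}{2}\big(S^\alpha(\omega)^\dagger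 S^\alpha(\omega)\otimes I+I\otimes\bar S^\alpha(\omega)^\dagger\bar S^\alpha(\omega)\big)\Big],$$ bars denoting entrywise complex conjugation. A block encoding of $\mathcal{Q}$ consists of an isometry $T$ and a reflection $R$ with $\mathcal{Q}=T^\dagger RT$. The standard method for spectral gap amplification takes as walk unitary $R(2\Pi-I)$, with $\Pi$ the projector onto the image of $T$. Determining the energies means ideal energy estimation: the ability to perform the unitaries $\Phi=\sum_p\sum_k\Pi_k\otimes|p-\varepsilon_k\rangle\langle p|$ and $\bar\Phi=\sum_p\sum_k\bar\Pi_k\otimes|p-\varepsilon_k\rangle\langle p|$, where $p$ runs over all possible values of an energy pointer register. ''Quadratically larger'' means that the phase gap is at least of order $\sqrt{\Delta}$, where $\Delta$ is the spectral gap of $\mathcal{L}$.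
   Formalization: The filter condition is taken as G(ω)=e^{-βω}G(-ω), as stationarity of σ requires; uniqueness of the eigenvector assumes σ is the only stationary state of L, and for the exactly implemented walk it is meant within the invariant subspace im T + R im T. *)

(* Defs.v *)
From HB Require Import structures.
From mathcomp Require Import all_boot all_order all_algebra.
From mathcomp Require Import sesquilinear spectral.
From mathcomp Require Import complex mxtens.
From mathcomp Require Import boolp classical_sets reals sequences exp trigo.

Set Implicit Arguments.
Unset Strict Implicit.
Unset Printing Implicit Defensive.

Import Order.TTheory GRing.Theory Num.Theory.

Local Open Scope ring_scope.
Local Open Scope sesquilinear_scope.
Local Open Scope complex_scope.

(** [M ^t*] is the conjugate transpose and [*t] the Kronecker product; kets are
    column vectors. *)

Definition mxconj (R : realType) (m n : nat) (A : 'M[R[i]]_(m, n)) :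
  'M[R[i]]_(m, n) := map_mx Num.conj A.

Definition reflection (R : realType) (n : nat) (A : 'M[R[i]]_n) : Prop :=
  A \is hermsymmx /\ A \is unitarymx.

Definition isometry (R : realType) (m n : nat) (T : 'M[R[i]]_(m, n)) : Prop :=
  T ^t* *m T = 1%:M.

(** * Hamiltonian and Gibbs state *)

Record hamiltonian (R : realType) (d m : nat) := Hamiltonian {
  energy : 'I_m -> R;
  eproj : 'I_m -> 'M[R[i]]_d;
  energy_inj : injective energy;
  energy_itv : forall k, 0 <= energy k <= 1;
  eproj_herm : forall k, eproj k \is hermsymmx;
  eproj_neq0 : forall k, eproj k != 0;
  eproj_mul : forall k l, eproj k *m eproj l = if k == l then eproj k else 0;
  eproj_sum : \sum_k eproj k = 1%:M
}.

(** [f(H)]; in particular [H] itself is [fun_of_ham H id]. *)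
Definition fun_of_ham (R : realType) (d m : nat) (H : hamiltonian R d m)
  (f : R -> R) : 'M[R[i]]_d := \sum_k (f (energy H k))%:C *: eproj H k.

Definition boltzmann (R : realType) (d m : nat) (H : hamiltonian R d m)
  (beta : R) : 'M[R[i]]_d := fun_of_ham H (fun e => expR (- beta * e)).

(** The trace of [boltzmann H beta] is a nonnegative real; [complex.Re] is the
    [R]-valued real part. *)
Definition partition_fun (R : realType) (d m : nat) (H : hamiltonian R d m)
  (beta : R) : R := complex.Re (\tr (boltzmann H beta)).

Definition gibbs (R : realType) (d m : nat) (H : hamiltonian R d m)
  (beta : R) : 'M[R[i]]_d := ((partition_fun H beta)^-1)%:C *: boltzmann H beta.

(** [sigma ^ (1/2)], obtained by applying [Num.sqrt] to the eigenvalues. *)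
Definition gibbs_sqrt (R : realType) (d m : nat) (H : hamiltonian R d m)
  (beta : R) : 'M[R[i]]_d :=
  fun_of_ham H (fun e => Num.sqrt (expR (- beta * e) / partition_fun H beta)).

Definition Omega (R : realType) (d : nat) : 'cV[R[i]]_(d * d) :=
  \sum_(x < d) ((delta_mx x 0 : 'cV_d) *t (delta_mx x 0 : 'cV_d)).

Definition gibbs_purif (R : realType) (d m : nat) (H : hamiltonian R d m)
  (beta : R) : 'cV[R[i]]_(d * d) :=
  (gibbs_sqrt H beta *t 1%:M) *m Omega R d.

Definition bohr (R : realType) (d m : nat) (H : hamiltonian R d m) : seq R :=
  undup [seq energy H k - energy H l | k <- enum 'I_m, l <- enum 'I_m].

(** * Davies generators *)

(** With the jump operators defined below, [jump S omega] raises the energy by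
    [omega], and [sigma S(omega) sigma^-1 = e^(- beta omega) S(omega)]. The Gibbs
    state is then stationary only if the rate of an [omega]-raising jump carries
    the factor [e^(- beta omega)]: this fixes the sign in [filter_db]. *)
Record davies (R : realType) (d m : nat) (H : hamiltonian R d m) (beta : R)
  (n : nat) := Davies {
  weight : 'I_n -> R;
  coupling : 'I_n -> 'M[R[i]]_d;
  filterG : 'I_n -> R -> R;
  weight_ge0 : forall a, 0 <= weight a;
  weight_sum : \sum_a weight a = 1;
  coupling_herm : forall a, coupling a \is hermsymmx;
  filter_ge0 : forall a omega, omega \in bohr H -> 0 <= filterG a omega;
  filter_db : forall a omega, omega \in bohr H ->
    filterG a omega = expR (- beta * omega) * filterG a (- omega)
}.

Definition jump (R : realType) (d m : nat) (H : hamiltonian R d m)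
  (S : 'M[R[i]]_d) (omega : R) : 'M[R[i]]_d :=
  \sum_(kl : 'I_m * 'I_m | energy H kl.1 - energy H kl.2 == omega)
    eproj H kl.1 *m S *m eproj H kl.2.

Definition davies_gen (R : realType) (d m n : nat) (H : hamiltonian R d m)
  (beta : R) (D : davies H beta n) (rho : 'M[R[i]]_d) : 'M[R[i]]_d :=
  \sum_(a < n) (weight D a)%:C *: \sum_(omega <- bohr H)
    let S := jump H (coupling D a) omega in
    (filterG D a omega)%:C *:
      (S *m rho *m S ^t*
       - 2%:R^-1 *: (S ^t* *m S *m rho + rho *m (S ^t* *m S))).

Definition discriminate (R : realType) (d m n : nat) (H : hamiltonian R d m)
  (beta : R) (D : davies H beta n) : 'M[R[i]]_(d * d) :=
  (1%:M *t 1%:M) + \sum_(a < n) (weight D a)%:C *: \sum_(omega <- bohr H)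
    let S := jump H (coupling D a) omega in
    let Sc := mxconj S in
    (Num.sqrt (filterG D a omega * filterG D a (- omega)))%:C *: (S *t Sc)
    - (filterG D a omega / 2%:R)%:C *:
        ((S ^t* *m S) *t 1%:M + 1%:M *t (Sc ^t* *m Sc)).

Definition hsnorm (R : realType) (d : nat) (X : 'M[R[i]]_d) : R :=
  Num.sqrt (complex.Re (\tr (X ^t* *m X))).

(** Operator norm on the Hilbert space of [d x d] matrices with the
    Hilbert-Schmidt inner product. *)
Definition superop_norm (R : realType) (d : nat)
  (L : 'M[R[i]]_d -> 'M[R[i]]_d) : R :=
  sup [set hsnorm (L X) | X in [set X : 'M[R[i]]_d | hsnorm X <= 1]]%classic.

(** The spectrum of a Davies generator is real and nonpositive, so the gap is
    the distance between its eigenvalue 0 and the rest of its spectrum.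
    [lin_mx L] is the matrix of [L]; [inf] of the empty set is 0. *)
Definition spectral_gap (R : realType) (d : nat)
  (L : 'M[R[i]]_d -> 'M[R[i]]_d) : R :=
  inf [set - complex.Re z | z in
        [set z : R[i] | eigenvalue (lin_mx L) z /\ z != 0]]%classic.

(** [sigma] is the only stationary state: the eigenvalue 0 of [L] is simple. *)
Definition unique_stationary (R : realType) (d : nat)
  (L : 'M[R[i]]_d -> 'M[R[i]]_d) (sigma : 'M[R[i]]_d) : Prop :=
  forall X, L X = 0 -> exists c : R[i], X = c *: sigma.

(** * Block encodings and walk unitaries *)

Definition block_encoding (R : realType) (D N : nat) (Q : 'M[R[i]]_D)
  (T : 'M[R[i]]_(N, D)) (Rf : 'M[R[i]]_N) : Prop :=
  [/\ isometry T, reflection Rf & Q = T ^t* *m Rf *m T].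

(** For an isometry [T], [T T^dagger] is the projector onto its image. *)
Definition walk (R : realType) (D N : nat) (T : 'M[R[i]]_(N, D))
  (Rf : 'M[R[i]]_N) : 'M[R[i]]_N :=
  Rf *m (2%:R *: (T *m T ^t*) - 1%:M).

(** The subspace [im T + Rf (im T)]. The walk leaves it invariant and acts as
    [- Rf] on its orthogonal complement, independently of the encoded matrix. *)
Definition in_walk_space (R : realType) (D N : nat) (T : 'M[R[i]]_(N, D))
  (Rf : 'M[R[i]]_N) (v : 'cV[R[i]]_N) : Prop :=
  exists x y : 'cV[R[i]]_D, v = T *m x + Rf *m (T *m y).

Definition is_eigenphase (R : realType) (N : nat) (W : 'M[R[i]]_N)
  (theta : R) : Prop :=
  - pi < theta <= pi /\ eigenvalue W (cos theta +i* sin theta).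

(** [inf] of the empty set is 0. *)
Definition phase_gap (R : realType) (N : nat) (W : 'M[R[i]]_N) : R :=
  inf [set `|theta| | theta in
        [set theta : R | is_eigenphase W theta /\ theta != 0]]%classic.

Definition fixes_only_in (R : realType) (N : nat) (W : 'M[R[i]]_N)
  (V : 'cV[R[i]]_N -> Prop) (psi : 'cV[R[i]]_N) : Prop :=
  forall v, V v -> W *m v = v -> exists c : R[i], v = c *: psi.

(** * Circuits with ideal energy estimation *)

(** An energy pointer register has basis states labelled by a finite abelian
    group (for instance the integers modulo [N], for energies that are multiples
    of a fixed unit). Energies are determined exactly when the subtraction of
    labels reproduces the Bohr frequencies. *)
Record pointer (R : realType) (d m : nat) (H : hamiltonian R d m) := Pointer {
  pointer_reg :> finZmodType;
  label : 'I_m -> pointer_reg;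
  label_exact : forall k l k' l' : 'I_m,
    label k - label l = label k' - label l' <->
    energy H k - energy H l = energy H k' - energy H l'
}.

(** [|p - e_k><p|] *)
Definition pointer_shift (R : realType) (d m : nat) (H : hamiltonian R d m)
  (P : pointer H) (k : 'I_m) (p : P) : 'M[R[i]]_#|P| :=
  delta_mx (enum_rank (p - label P k)) (enum_rank p).

(** The total space is (system (x) conjugate system) (x) (pointer (x) work),
    with a work register of dimension [a]. *)
Definition energy_est (R : realType) (d m : nat) (H : hamiltonian R d m)
  (P : pointer H) (a : nat) : 'M[R[i]]_(d * d * (#|P| * a)) :=
  \sum_(p : P) \sum_k
    (eproj H k *t 1%:M) *t (pointer_shift k p *t 1%:M).

Definition energy_est_conj (R : realType) (d m : nat) (H : hamiltonian R d m)
  (P : pointer H) (a : nat) : 'M[R[i]]_(d * d * (#|P| * a)) :=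
  \sum_(p : P) \sum_k
    (1%:M *t mxconj (eproj H k)) *t (pointer_shift k p *t 1%:M).

(** [A] on the systems, controlled on the range of the ancilla projector [E]. *)
Definition controlled (R : realType) (D N : nat) (A : 'M[R[i]]_D)
  (E : 'M[R[i]]_N) : 'M[R[i]]_(D * N) :=
  A *t E + 1%:M *t (1%:M - E).

(** Operators obtained from ideal energy estimation, controlled coupling
    operators, and unitaries that act on the ancillas only. The systems are
    accessed through energy estimation and the couplings exclusively. *)
Inductive implementable (R : realType) (d m n : nat) (H : hamiltonian R d m)
  (beta : R) (D : davies H beta n) (P : pointer H) (a : nat) :
  'M[R[i]]_(d * d * (#|P| * a)) -> Prop :=
| impl_est : implementable D (energy_est P a)
| impl_est_conj : implementable D (energy_est_conj P a)
| impl_coupling (j : 'I_n) (E : 'M[R[i]]_(#|P| * a)) :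
    E \is hermsymmx -> E *m E = E ->
    implementable D (controlled (coupling D j *t 1%:M) E)
| impl_coupling_conj (j : 'I_n) (E : 'M[R[i]]_(#|P| * a)) :
    E \is hermsymmx -> E *m E = E ->
    implementable D (controlled (1%:M *t mxconj (coupling D j)) E)
| impl_ancilla (V : 'M[R[i]]_(#|P| * a)) :
    V \is unitarymx -> implementable D (1%:M *t V)
| impl_adj (U : 'M[R[i]]_(d * d * (#|P| * a))) :
    implementable D U -> implementable D (U ^t*)
| impl_mul (U V : 'M[R[i]]_(d * d * (#|P| * a))) :
    implementable D U -> implementable D V -> implementable D (U *m V).

(** The isometry [|psi> |-> |psi> (x) |j>]. *)
Definition attach (R : realType) (D N : nat) (j : 'I_N) : 'M[R[i]]_(D * N, D) :=
  castmx (erefl, muln1 D) (1%:M *t (delta_mx j 0 : 'cV[R[i]]_N)).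

Definition implementable_block_encoding (R : realType) (d m n : nat)
  (H : hamiltonian R d m) (beta : R) (D : davies H beta n) (P : pointer H)
  (a : nat) (T : 'M[R[i]]_(d * d * (#|P| * a), d * d))
  (Rf : 'M[R[i]]_(d * d * (#|P| * a))) : Prop :=
  implementable D Rf /\
  exists U j, implementable D U /\ T = U *m attach R (d * d) j.

(* Main.v *)
(** Every walk [W = Rf (2 T T^dagger - 1)] satisfies
    [2 mu Q (T^dagger v) = (1 + mu^2) T^dagger v] whenever [W v = mu v]. So an
    eigenphase [theta] different from 0 either has [cos theta] in the spectrum of
    [Q], or is [pi]. Since [1 - cos theta <= theta^2 / 2], a gap [Delta] below the
    eigenvalue 1 of [Q] becomes a phase gap of at least [sqrt Delta]. Conjugation
    by [sigma^(1/4)] turns the Davies generator into [Q - 1], which transports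
    the gap and the stationary state.

    The block encoding superposes the transition [S(omega)] on the system with
    the transition on the conjugate system, each with an ancilla rotated by
    [G(omega)]; the reflection acts on the ancillas only, and exchanges the two
    branches together with [omega] and [- omega] when the ancilla is set. The
    isometry property is [sum_omega S(omega)^dagger S(omega) = 1], which holds
    because [S] is a reflection. With energy estimation [Phi], the transition is
    [Phi S Phi^dagger], which leaves [- omega] in the pointer.

    On the complement of [im T + Rf (im T)] the walk is [- Rf], which may have
    the eigenvalue 1. For the unrestricted statement the reflection is therefore
    rebuilt from the spectral decomposition of [Q]. *)

Require Import Defs.
From HB Require Import structures.
From mathcomp Require Import all_boot all_order all_algebra.
From mathcomp Require Import sesquilinear spectral complex mxtens.
From mathcomp Require Import boolp classical_sets reals sequences exp trigo.
From mathcomp Require topology normedtype derive.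
From mathcomp Require Import ring lra.
Import Order.TTheory GRing.Theory Num.Theory.
Local Open Scope ring_scope.
Local Open Scope sesquilinear_scope.
Local Open Scope complex_scope.

Set Implicit Arguments.
Unset Strict Implicit.
Unset Printing Implicit Defensive.

(** * Conjugate transposes *)

Section Adjoint.
Variable R : realType.
Local Notation C := R[i].

Lemma adjmxM m n p (A : 'M[C]_(m, n)) (B : 'M_(n, p)) :
  (A *m B)^t* = B^t* *m A^t*.
Proof. by rewrite trmx_mul map_mxM. Qed.

Lemma adjmxD m n (A B : 'M[C]_(m, n)) : (A + B)^t* = A^t* + B^t*.
Proof. by rewrite linearD map_mxD. Qed.

Lemma adjmxB m n (A B : 'M[C]_(m, n)) : (A - B)^t* = A^t* - B^t*.
Proof. by rewrite linearB map_mxB. Qed.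

Lemma adjmxN m n (A : 'M[C]_(m, n)) : (- A)^t* = - A^t*.
Proof. by rewrite linearN map_mxN. Qed.

Lemma adjmxZ m n (c : R) (A : 'M[C]_(m, n)) : (c%:C *: A)^t* = c%:C *: A^t*.
Proof. by rewrite linearZ map_mxZ; congr (_ *: _); apply: conjc_real. Qed.

Lemma adjmxZn m n k (A : 'M[C]_(m, n)) : (k%:R *: A)^t* = k%:R *: A^t*.
Proof. by rewrite -(rmorph_nat (real_complex R)) adjmxZ. Qed.

Lemma adjmx1 n : (1%:M : 'M[C]_n)^t* = 1%:M.
Proof. by rewrite trmx1 map_mx1. Qed.

Lemma adjmx0 m n : (0 : 'M[C]_(m, n))^t* = 0.
Proof. by rewrite trmx0 map_mx0. Qed.

Lemma adjmx_sum I (r : seq I) (P : pred I) m n (F : I -> 'M[C]_(m, n)) :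
  (\sum_(i <- r | P i) F i)^t* = \sum_(i <- r | P i) (F i)^t*.
Proof. by rewrite linear_sum raddf_sum. Qed.

Lemma adjmx_tens m n p q (A : 'M[C]_(m, n)) (B : 'M[C]_(p, q)) :
  (A *t B)^t* = A^t* *t B^t*.
Proof. by rewrite trmx_tens map_mxT. Qed.

Lemma hermsymmxE n (A : 'M[C]_n) : (A \is hermsymmx) = (A == A^t*).
Proof. by rewrite is_hermitianmxE expr0 scale1r. Qed.

Lemma hermP n (A : 'M[C]_n) : reflect (A^t* = A) (A \is hermsymmx).
Proof. by rewrite hermsymmxE eq_sym; apply: eqP. Qed.

Lemma adjmx_mul_ge0 n (v : 'cV[C]_n) : 0 <= (v^t* *m v) 0 0.
Proof.
rewrite mxE sumr_ge0 // => i _; rewrite !mxE mulrC; exact: mul_conjC_ge0.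
Qed.

Lemma adjmx_mul_eq0 m n (v : 'M[C]_(m, n)) : v^t* *m v = 0 -> v = 0.
Proof.
move=> /matrixP v0; apply/matrixP => i j; have := v0 j j; rewrite !mxE.
move/eqP; rewrite psumr_eq0; last first.
  by move=> k _; rewrite !mxE mulrC mul_conjC_ge0.
by move/allP/(_ i (mem_index_enum _)); rewrite /= !mxE mulrC mul_conjC_eq0 => /eqP.
Qed.

(** [eigenvalue] speaks of row vectors, whereas kets are columns. A matrix and its transpose have
    the same spectrum because [A - a] and its transpose are singular together. *)
Lemma eigenvalue_colP n (A : 'M[C]_n) a :
  eigenvalue A a <-> exists2 v : 'cV_n, v != 0 & A *m v = a *: v.
Proof.
have eigT (B : 'M[C]_n) : eigenvalue B a = (B - a%:M \notin unitmx).
  by rewrite /eigenvalue /eigenspace kermx_eq0 row_free_unit.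
have -> : eigenvalue A a = eigenvalue A^T a.
  by rewrite !eigT -[A - _]trmxK unitmx_tr linearB /= tr_scalar_mx.
split.
  move=> /eigenvalueP[v Av v0]; exists v^T; first by rewrite trmx_eq0.
  by rewrite -[A]trmxK -trmx_mul Av linearZ.
move=> [v v0 Av]; apply/eigenvalueP; exists v^T; last by rewrite trmx_eq0.
by rewrite -trmx_mul Av linearZ.
Qed.

End Adjoint.

(** * Estimates on cosines and phases *)

Section Trigonometry.
Import topology normedtype derive numFieldNormedType.Exports.
Local Open Scope classical_set_scope.
Variable R : realType.

(** Half-angle formula: 1 - cos x = 2 sin(x/2)^2, and |sin t| <= |t|. *)
Lemma cos_ge_quadratic (x : R) : 1 - cos x <= x ^+ 2 / 2.
Proof.
have sin_le (t : R) : 0 <= t -> sin t <= t.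
  rewrite le_eqVlt => /predU1P[<-|t0]; first by rewrite sin0.
  have cont : {within `[0, t], continuous (@sin R)}.
    by apply: continuous_subspaceT => y; apply: continuous_sin.
  have [c _] := MVT t0 (fun y _ => is_derive_sin y) cont.
  rewrite sin0 !subr0 => ->.
  by rewrite ler_piMl ?cos_le1 // ltW.
have sin_sqr : sin (x / 2) ^+ 2 <= (x / 2) ^+ 2.
  have norm_sin (t : R) : 0 <= t -> `|sin t| <= t.
    move=> t0; case: (lerP t 1) => t1; last by rewrite (le_trans (sin_max _)) ?ltW.
    rewrite ger0_norm ?sin_le // sin_ge0_pi // t0 (le_trans t1) //.
    by rewrite (le_trans _ (pi_ge2 _)) // ler1n.
  rewrite -real_normK ?num_real // -[leRHS]real_normK ?num_real //.
  rewrite lerXn2r ?nnegrE //; case: (leP 0 (x / 2)) => t0.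
    by rewrite [leRHS]ger0_norm ?norm_sin.
  by rewrite [leRHS]ltr0_norm // -normrN -sinN norm_sin // oppr_ge0 ltW.
have -> : x = (x / 2) *+ 2 by rewrite -mulr_natr divfK // pnatr_eq0.
rewrite cos_mulr2n cos2sin2; move: sin_sqr; set s := sin _ ^+ 2; set t := x / 2.
by rewrite mulr2n [leRHS]/=; lra.
Qed.

(** For mu of modulus 1, 1 + mu^2 = mu (conj mu + mu). This turns the compressed eigenvalue equation
    of the walk into an eigenvalue equation of [Q] with eigenvalue cos t. *)
Lemma expi_sqr (t : R) :
  1 + (cos t +i* sin t) ^+ 2 = (2 * cos t)%:C * (cos t +i* sin t) :> R[i].
Proof.
rewrite expr2; apply/eqP; rewrite eq_complex /=; apply/andP; split; apply/eqP.
  by have := cos2Dsin2 t; lra.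
by lra.
Qed.

End Trigonometry.

(** * Walks of block encodings *)

Section Walk.
Variable R : realType.
Local Notation C := R[i].
Variables (D N : nat) (Q : 'M[C]_D) (T : 'M[C]_(N, D)) (Rf : 'M[C]_N).
Hypothesis QTR : block_encoding Q T Rf.
Local Notation W := (walk T Rf).

Let Tiso : T^t* *m T = 1%:M. Proof. by case: QTR. Qed.
Let Rherm : Rf^t* = Rf. Proof. by case: QTR => _ [/hermP]. Qed.
Let Rsqr : Rf *m Rf = 1%:M.
Proof. by case: QTR => _ [_ /unitarymxP]; rewrite Rherm. Qed.
Let Qdef : Q = T^t* *m Rf *m T. Proof. by case: QTR. Qed.

Lemma block_encoding_herm : Q^t* = Q.
Proof. by rewrite Qdef !adjmxM trmxCK Rherm mulmxA. Qed.

Let proj_refl_sqr :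
  (2%:R *: (T *m T^t*) - 1%:M) *m (2%:R *: (T *m T^t*) - 1%:M) = 1%:M.
Proof.
rewrite mulmxBl mulmxBr !mulmx1 mul1mx -scalemxAl -scalemxAr.
rewrite -[T *m _ *m (T *m _)]mulmxA [T^t* *m _]mulmxA Tiso mul1mx scalerA.
by move: (T *m _) => X; apply/matrixP=> i j; rewrite !mxE; ring.
Qed.

Lemma walk_unitary : W \is unitarymx.
Proof.
apply/unitarymxP; rewrite /walk adjmxM Rherm adjmxB adjmx1.
rewrite adjmxZn adjmxM trmxCK mulmxA -[Rf *m _ *m _]mulmxA.
by rewrite proj_refl_sqr mulmx1.
Qed.

Lemma walk_img (x : 'cV[C]_D) : W *m (T *m x) = Rf *m (T *m x).
Proof.
rewrite /walk -mulmxA mulmxBl mul1mx -scalemxAl -[T *m _ *m _]mulmxA.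
rewrite [T^t* *m _]mulmxA Tiso mul1mx.
by congr (_ *m _); apply/matrixP=> i j; rewrite !mxE; ring.
Qed.

(** Together with [walk_img], this shows that for an eigenvector [x] of [Q] the walk preserves the
    span of [T *m x] and [Rf *m (T *m x)]. *)
Lemma walk_refl_img (x : 'cV[C]_D) :
  W *m (Rf *m (T *m x)) = 2%:R *: (Rf *m (T *m (Q *m x))) - T *m x.
Proof.
rewrite /walk -mulmxA mulmxBl mul1mx -scalemxAl mulmxBr -scalemxAr.
rewrite [Rf *m (Rf *m _)]mulmxA Rsqr mul1mx.
by rewrite Qdef !mulmxA.
Qed.

Lemma walk_eigenvector mu (v : 'cV[C]_N) : W *m v = mu *: v ->
  2%:R *: (T *m (T^t* *m v)) = v + mu *: (Rf *m v).
Proof.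
rewrite /walk -mulmxA => /(congr1 (mulmx Rf)); rewrite mulmxA Rsqr mul1mx.
rewrite mulmxBl mul1mx -scalemxAl -scalemxAr -mulmxA => /eqP.
by rewrite subr_eq addrC => /eqP.
Qed.

(** The identity of [walk_eigenvector] is compressed twice: T^dagger gives x = mu T^dagger Rf v, and
    T^dagger Rf gives 2 Q x = T^dagger Rf v + mu x, where x = T^dagger v. Multiplying the second by
    mu eliminates T^dagger Rf v. *)
Lemma walk_eigenvector_compress mu (v : 'cV[C]_N) : W *m v = mu *: v ->
  (2%:R * mu) *: (Q *m (T^t* *m v)) = (1 + mu ^+ 2) *: (T^t* *m v).
Proof.
move=> /walk_eigenvector Wv; set x := T^t* *m v in Wv *.
have xE : x = mu *: (T^t* *m (Rf *m v)).
  have := congr1 (mulmx (T^t*)) Wv; rewrite -scalemxAr mulmxA Tiso mul1mx.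
  by rewrite mulmxDr -/x scaler_nat mulr2n -scalemxAr => /addrI.
have QxE : 2%:R *: (Q *m x) = T^t* *m (Rf *m v) + mu *: x.
  have := congr1 (mulmx (T^t* *m Rf)) Wv.
  rewrite -scalemxAr (mulmxA _ T x) -Qdef mulmxDr -scalemxAr => ->.
  by rewrite -!(mulmxA (T^t*)) (mulmxA Rf Rf) Rsqr mul1mx.
by rewrite mulrC -scalerA QxE scalerDr -xE scalerDl scale1r scalerA expr2.
Qed.

(** On the kernel of T^dagger the walk is [- Rf], an involution. *)
Lemma walk_eigenvector_orth mu (v : 'cV[C]_N) : W *m v = mu *: v ->
  v != 0 -> T^t* *m v = 0 -> mu ^+ 2 = 1.
Proof.
move=> /walk_eigenvector Wv v0 x0; move: Wv; rewrite x0 mulmx0 scaler0 => vE.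
have {}vE : v = - mu *: (Rf *m v).
  by apply/eqP; rewrite scaleNr -addr_eq0 -vE.
have : (1 - mu ^+ 2) *: v = 0.
  rewrite scalerBl scale1r {1}vE {1}vE -scalemxAr mulmxA Rsqr mul1mx.
  by rewrite scalerA mulrNN expr2 subrr.
by move/eqP; rewrite scaler_eq0 (negPf v0) orbF subr_eq0 => /eqP.
Qed.

(** Equality case of Cauchy-Schwarz: the squared norm of Rf T x - T x is 2 (x, x) - 2 (x, Q x),
    which vanishes. *)
Lemma walk_fix (x : 'cV[C]_D) : Q *m x = x -> W *m (T *m x) = T *m x.
Proof.
move=> Qx; rewrite walk_img; apply/eqP; rewrite -subr_eq0; apply/eqP.
apply: adjmx_mul_eq0; rewrite adjmxB mulmxBl !mulmxBr !adjmxM Rherm.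
have TT (y z : 'cV[C]_D) : y^t* *m T^t* *m (T *m z) = y^t* *m z.
  by rewrite -mulmxA (mulmxA (T^t*)) Tiso mul1mx.
rewrite TT -!mulmxA (mulmxA Rf Rf) Rsqr mul1mx.
rewrite (mulmxA (T^t*) T) Tiso mul1mx (mulmxA (T^t*) Rf) (mulmxA (T^t* *m Rf)) -Qdef Qx.
by rewrite !subrr.
Qed.

Lemma iso_neq0 (x : 'cV[C]_D) : x != 0 -> T *m x != 0.
Proof.
by apply: contra_neq => Tx0; rewrite -[x]mul1mx -Tiso -mulmxA Tx0 mulmx0.
Qed.

(** The squared norms of Rf T x + T x and Rf T x - T x are 2 (1 + a) and 2 (1 - a) times that of x.
    In the order of [R[i]] the conclusion also says that [a] is real. *)
Lemma block_encoding_eigen_itv a : eigenvalue Q a -> -1 <= a <= 1.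
Proof.
move=> /eigenvalue_colP[x x0 Qx].
have nx : 0 < (x^t* *m x) 0 0.
  rewrite lt_def adjmx_mul_ge0 andbT; apply: contra_neq x0 => x0.
  by apply: adjmx_mul_eq0; apply/matrixP => i j; rewrite !ord1 x0 mxE.
have TRT : x^t* *m T^t* *m (Rf *m (T *m x)) = a *: (x^t* *m x).
  by rewrite -mulmxA (mulmxA (T^t*) Rf) (mulmxA (T^t* *m Rf)) -Qdef Qx scalemxAr.
have TT : x^t* *m T^t* *m (T *m x) = x^t* *m x.
  by rewrite -mulmxA (mulmxA (T^t*)) Tiso mul1mx.
have TRRT : x^t* *m T^t* *m Rf *m (Rf *m (T *m x)) = x^t* *m x.
  by rewrite -(mulmxA _ Rf) (mulmxA Rf Rf) Rsqr mul1mx.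
apply/andP; split.
  have := adjmx_mul_ge0 (Rf *m (T *m x) + T *m x).
  rewrite adjmxD mulmxDl !mulmxDr !adjmxM Rherm TRT TRRT TT -(mulmxA _ Rf) TRT.
  rewrite !mxE; set n := (X in _ + a * X).
  rewrite (_ : _ + _ + _ = 2 * ((1 + a) * (x^t* *m x) 0 0)); last by rewrite /n mxE; ring.
  by rewrite pmulr_rge0 // pmulr_lge0 // => ?; rewrite -subr_ge0 opprK addrC.
have := adjmx_mul_ge0 (Rf *m (T *m x) - T *m x).
rewrite adjmxB mulmxBl !mulmxBr !adjmxM Rherm TRT TRRT TT -(mulmxA _ Rf) TRT.
rewrite !mxE; set n := (X in _ - a * X).
rewrite (_ : _ - _ - _ = 2 * ((1 - a) * (x^t* *m x) 0 0)); last by rewrite /n mxE; ring.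
by rewrite pmulr_rge0 // pmulr_lge0 // subr_ge0.
Qed.

(* As [Rf u = - u], the defect [u] is orthogonal to [Rf (im T)] as well as to
   [im T]. *)
Lemma walk_fixed_defect (v : 'cV[C]_N) : W *m v = v ->
  let z := T^t* *m v in let u := v - T *m z in
  [/\ Q *m z = z, Rf *m (T *m z) = T *m z, T^t* *m u = 0 & Rf *m u = - u].
Proof.
move=> Wv z u; have Wv1 : W *m v = 1 *: v by rewrite scale1r.
have := walk_eigenvector_compress Wv1; rewrite mulr1 expr1n => Qz.
have {}Qz : Q *m z = z.
  by apply: (@scalerI _ _ (2 : C)); rewrite ?pnatr_eq0 // Qz.
have vRv := walk_eigenvector Wv1; rewrite scale1r -/z in vRv.
have RTz : Rf *m (T *m z) = T *m z by rewrite -walk_img walk_fix.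
split => //; first by rewrite mulmxBr mulmxA Tiso mul1mx subrr.
have RvE : Rf *m v = 2%:R *: (T *m z) - v by rewrite vRv addrC addKr.
by rewrite /u mulmxBr RTz opprB RvE scaler_nat mulr2n addrAC addrK.
Qed.

(** The defect [u] of a fixed vector lies in the walk space, yet is orthogonal to im T and to Rf (im
    T); hence it is orthogonal to itself. *)
Lemma fixes_only_in_walk_space (x : 'cV[C]_D) :
  (forall z, Q *m z = z -> exists c : C, z = c *: x) ->
  fixes_only_in W (in_walk_space T Rf) (T *m x).
Proof.
move=> Qfix v [y [y' vE]] Wv; have [Qz RTz Tu Ru] := walk_fixed_defect Wv.
set z := T^t* *m v in Qz RTz Tu Ru; set u := v - T *m z in Tu Ru.
have uT : u^t* *m T = 0 by rewrite -[LHS]trmxCK adjmxM trmxCK Tu adjmx0.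
have uR : u^t* *m Rf = - u^t*.
  by rewrite -Rherm -adjmxM Ru adjmxN.
have u0 : u = 0.
  apply: adjmx_mul_eq0; rewrite {2}/u vE !(mulmxDr, mulmxN, mulNmx).
  by rewrite !mulmxA uR uT !(mulNmx, mul0mx) uT !mul0mx !oppr0 !addr0.
have [c zE] := Qfix _ Qz; exists c.
by move/eqP: u0; rewrite subr_eq0 => /eqP ->; rewrite zE scalemxAr.
Qed.

Lemma fixes_only_in_full (x : 'cV[C]_D) :
  (forall u : 'cV_N, T^t* *m u = 0 -> Rf *m u = - u -> u = 0) ->
  (forall z, Q *m z = z -> exists c : C, z = c *: x) ->
  fixes_only_in W (fun _ => True) (T *m x).
Proof.
move=> orth0 Qfix v _ Wv; have [Qz _ Tu Ru] := walk_fixed_defect Wv.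
have /eqP := orth0 _ Tu Ru; rewrite subr_eq0 => /eqP ->.
by have [c ->] := Qfix _ Qz; exists c; rewrite scalemxAr.
Qed.

(** On T x the walk satisfies (W - mu) (W - nu) = 0, with nu the conjugate of mu. So (W - nu) T x is
    an eigenvector for mu unless it vanishes; in that case compression by T^dagger gives nu = l,
    hence mu = nu, and T x itself serves. *)
Lemma walk_eigenvalue_acos (l : R) : eigenvalue Q l%:C ->
  eigenvalue W (cos (acos l) +i* sin (acos l)).
Proof.
move=> ql; have := block_encoding_eigen_itv ql.
rewrite -(rmorphN1 (real_complex R)) -(rmorph1 (real_complex R)) !lecR => l1.
have [x x0 Qx] := (eigenvalue_colP _ _).1 ql.
set mu := _ +i* _; set nu := mu^*.
have mun : mu + nu = 2%:R * l%:C.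
  by rewrite addcJ /= acosK.
have munu : mu * nu = 1.
  apply/eqP; rewrite eq_complex /=; apply/andP; split; apply/eqP; last by ring.
  by have := cos2Dsin2 (acos l); lra.
have nuE : nu = 2%:R * l%:C - mu by rewrite -mun addrC addKr.
apply/eigenvalue_colP; have [v0|v0] := eqVneq (W *m (T *m x) - nu *: (T *m x)) 0.
  exists (T *m x); first exact: iso_neq0.
  move/eqP: v0; rewrite subr_eq0 => /eqP v0.
  suff -> : mu = nu by [].
  have /(congr1 (mulmx (T^t*))) := v0; rewrite walk_img (mulmxA _ Rf) (mulmxA _ T) -Qdef Qx.
  rewrite -scalemxAr (mulmxA (T^t*)) Tiso mul1mx => /eqP; rewrite -subr_eq0 -scalerBl.
  rewrite scaler_eq0 (negPf x0) orbF subr_eq0 => /eqP ln.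
  have -> : mu = 2%:R * l%:C - nu by rewrite -mun addrK.
  by rewrite -ln; ring.
exists (W *m (T *m x) - nu *: (T *m x)) => //.
rewrite mulmxBr -scalemxAr {1}walk_img walk_refl_img !walk_img Qx -!scalemxAr.
rewrite scalerBr !scalerA munu scale1r nuE scalerBl.
by rewrite addrAC subKr.
Qed.

(** The bound [delta <= 2] covers the eigenphase pi, which need not come from [Q]. The last
    hypothesis provides a nonzero eigenphase, so that the infimum is not the value 0 assigned to the
    empty set. *)
Lemma sqrt_le_phase_gap (delta : R) :
  delta <= 2%:R ->
  (forall l : R, eigenvalue Q l%:C -> l != 1 -> delta <= 1 - l) ->
  (0 < delta -> exists2 l : R, eigenvalue Q l%:C & l != 1) ->
  Num.sqrt delta <= phase_gap W.
Proof.
move=> d2 gap_le ex_eig; rewrite /phase_gap; set A := (X in inf X).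
have [d0|d0] := leP delta 0.
  rewrite ler0_sqrtr //; have [->|/set0P A0] := eqVneq A set0; first by rewrite inf0.
  by apply: lb_le_inf => // _ [t _ <-].
have [l ql l1] := ex_eig d0.
have := block_encoding_eigen_itv ql.
rewrite -(rmorphN1 (real_complex R)) -(rmorph1 (real_complex R)) !lecR => lI.
apply: lb_le_inf.
  exists `|acos l|, (acos l) => //; split; last first.
    by rewrite gt_eqF // acos_gt0 // lt_neqAle l1.
  split; last exact: walk_eigenvalue_acos.
  by rewrite acos_lepi // andbT (lt_le_trans _ (acos_ge0 _)) // oppr_lt0 pi_gt0.
move=> _ [t [[tI /eigenvalue_colP[v v0 Wv]] t0] <-].
suff dt : delta <= 1 - cos t.
  rewrite -(ler_sqr (sqrtr_ge0 _)) ?nnegrE // sqr_sqrtr ?ltW //.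
  rewrite real_normK ?num_real //.
  have := cos_ge_quadratic t; have := sqr_ge0 t; lra.
set mu := _ +i* _ in Wv.
have mu0 : mu != 0.
  apply/eqP => -[c0 s0]; have := cos2Dsin2 t; rewrite c0 s0 expr0n addr0.
  by move/eqP; rewrite eq_sym oner_eq0.
(* Cosine is injective on [0, pi], and |t| lies there. *)
have cos_neq1 : cos t != 1.
  apply: contra_neq t0 => ct; have : cos `|t| = cos 0 by rewrite cos_norm ct cos0.
  move/cos_inj; rewrite !in_itv /= normr_ge0 lexx pi_ge0 ler_norml /=.
  by case/andP: tI => /ltW -> -> /(_ isT isT) /normr0_eq0.
have [x0|x0] := eqVneq (T^t* *m v) 0; last first.
  apply: gap_le cos_neq1; apply/eigenvalue_colP; exists (T^t* *m v) => //.
  have := walk_eigenvector_compress Wv; rewrite expi_sqr.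
  have -> : (2 * cos t)%:C * mu = 2%:R * mu * (cos t)%:C.
    by rewrite rmorphM rmorph_nat -/mu; ring.
  rewrite -[X in _ = X -> _]scalerA => /scalerI; apply.
  by rewrite mulf_neq0 // pnatr_eq0.
(* Only mu = -1 remains, where 1 - cos t = 2. *)
have := walk_eigenvector_orth Wv v0 x0 => /eqP; rewrite sqrf_eq1.
case/orP => /eqP[ct _]; first by rewrite ct eqxx in cos_neq1.
by rewrite ct opprK.
Qed.

End Walk.

(** * Block vectors *)

Section Blocks.
Variable R : realType.
Local Notation C := R[i].

Lemma tensmx11 m n : (1%:M : 'M[C]_m) *t (1%:M : 'M[C]_n) = 1%:M.
Proof.
apply/matrixP => i j; rewrite -(mxtens_unindexK i) -(mxtens_unindexK j).
case: (mxtens_unindex i) (mxtens_unindex j) => [i1 i2] [j1 j2].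
rewrite tensmxE !mxE (can_eq (@mxtens_indexK m n)) xpair_eqE -natrM.
by case: (i1 == j1); case: (i2 == j2).
Qed.

(** This is (1 (x) <y|) M. Operators on the systems act on every block separately, so identities
    between circuits are checked one ancilla label at a time. *)
Definition block m N n (M : 'M[C]_(m * N, n)) (y : 'I_N) : 'M_(m, n) :=
  \matrix_(i, j) M (mxtens_index (i, y)) j.

Lemma big_mxtens_index (V : nmodType) m N (F : 'I_(m * N) -> V) :
  \sum_k F k = \sum_(y < N) \sum_(i < m) F (mxtens_index (i, y)).
Proof.
rewrite exchange_big pair_big /= (reindex (@mxtens_index m N)) /=.
  by apply: eq_bigr => -[].
by exists (@mxtens_unindex m N) => x _; rewrite (mxtens_indexK, mxtens_unindexK).
Qed.

Lemma sum_deltaZ (V : lmodType C) (K : finType) (F : K -> V) k0 :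
  \sum_k (k == k0)%:R *: F k = F k0.
Proof.
rewrite (bigD1 k0) //= eqxx scale1r big1 ?addr0 // => k /negPf ->.
by rewrite scale0r.
Qed.

Lemma block_tens_mul m N n (A : 'M[C]_m) (E : 'M[C]_N) (M : 'M[C]_(m * N, n)) y :
  block ((A *t E) *m M) y = \sum_x E y x *: (A *m block M x).
Proof.
apply/matrixP => i j; rewrite summxE !mxE big_mxtens_index.
apply: eq_bigr => x _; rewrite !mxE mulr_sumr; apply: eq_bigr => k _.
by rewrite tensmxE !mxE; ring.
Qed.

Lemma block_sum m N n I (r : seq I) (F : I -> 'M[C]_(m * N, n)) y :
  block (\sum_(i <- r) F i) y = \sum_(i <- r) block (F i) y.
Proof.
apply/matrixP => i j; rewrite summxE !mxE summxE.
by apply: eq_bigr => k _; rewrite !mxE.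
Qed.

Lemma blockD m N n (M M' : 'M[C]_(m * N, n)) y :
  block (M + M') y = block M y + block M' y.
Proof. by apply/matrixP => i j; rewrite !mxE. Qed.

Lemma adjmx_mul_block m N n p (M : 'M[C]_(m * N, n)) (M' : 'M[C]_(m * N, p)) :
  M^t* *m M' = \sum_y (block M y)^t* *m block M' y.
Proof.
apply/matrixP => i j; rewrite summxE !mxE big_mxtens_index.
by apply: eq_bigr => y _; rewrite !mxE; apply: eq_bigr => k _; rewrite !mxE.
Qed.

Lemma block_attach m N (j y : 'I_N) :
  block (attach R m j) y = (y == j)%:R *: 1%:M.
Proof.
apply/matrixP => i k; rewrite !mxE /attach castmxE /= cast_ord_id.
have -> : cast_ord (esym (muln1 m)) k = mxtens_index (k, ord0 : 'I_1).
  by apply: val_inj; rewrite /= muln1 addn0.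
by rewrite tensmxE !mxE eqxx andbT mulrC.
Qed.

Lemma block_controlled m N n (A : 'M[C]_m) (E : 'M[C]_N)
  (M : 'M[C]_(m * N, n)) (c : 'I_N -> bool) :
  E = \matrix_(i, j) ((i == j) && c i)%:R ->
  forall y, block (controlled A E *m M) y =
    (if c y then A else 1%:M) *m block M y.
Proof.
move=> -> y; rewrite /controlled mulmxDl blockD !block_tens_mul.
rewrite (bigD1 y) //= [X in _ + X + _]big1; last first.
  by move=> x xy; rewrite mxE eq_sym (negPf xy) scale0r.
rewrite (bigD1 y) //= [X in _ + (_ + X)]big1; last first.
  by move=> x xy; rewrite !mxE eq_sym (negPf xy) subrr scale0r.
rewrite !mxE eqxx; case: (c y); rewrite ?subrr ?subr0 !scale1r scale0r !addr0 //.
by rewrite add0r.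
Qed.

End Blocks.

(** * Ancilla basis states labelled by pairs *)

Section Labels.
Variables (R : realType) (I K : finType).
Local Notation C := R[i].

Definition lbl (i : I) (w : K) : 'I_(#|I| * #|K|) :=
  mxtens_index (enum_rank i, enum_rank w).

Definition unlbl (k : 'I_(#|I| * #|K|)) : I * K :=
  (enum_val (mxtens_unindex k).1, enum_val (mxtens_unindex k).2).

Lemma lblK i w : unlbl (lbl i w) = (i, w).
Proof. by rewrite /unlbl /lbl mxtens_indexK /= !enum_rankK. Qed.

Lemma unlblK k : lbl (unlbl k).1 (unlbl k).2 = k.
Proof. by rewrite /lbl /unlbl !enum_valK -surjective_pairing mxtens_unindexK. Qed.

Lemma lbl_eq i w i' w' : (lbl i w == lbl i' w') = (i == i') && (w == w').
Proof.
apply/eqP/andP => [e|[/eqP-> /eqP->] //].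
by have := congr1 unlbl e; rewrite !lblK => -[-> ->].
Qed.

Lemma big_lbl (V : nmodType) (F : 'I_(#|I| * #|K|) -> V) :
  \sum_k F k = \sum_i \sum_w F (lbl i w).
Proof.
rewrite pair_big /= (reindex (fun p => lbl p.1 p.2)) //=.
by exists unlbl => [[i w] _|k _]; rewrite (lblK, unlblK).
Qed.

End Labels.

(** * Block encoding of a family of transitions *)

(* [A] acts on the system ([b = false]), its conjugate on the conjugate system
   ([b = true]). *)
HB.lock Definition side (R : realType) (d : nat) (b : bool) (A : 'M[R[i]]_d) :
    'M[R[i]]_(d * d) :=
  if b then 1%:M *t mxconj A else A *t 1%:M.

(** The first root is the amplitude of coupling [a] on one of the two sides, the second that of the
    flag after the rotation by the filter. *)
HB.lock Definition jump_block (R : realType) (d n : nat) (I : Type)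
    (w : 'I_n -> R) (J : 'I_n -> I -> 'M[R[i]]_d) (g : 'I_n -> I -> R)
    (i : I) (a : 'I_n) (b f : bool) : 'M[R[i]]_(d * d) :=
  (Num.sqrt (w a / 2) * Num.sqrt (if f then g a i else 1 - g a i))%:C
    *: side b (J a i).

Arguments side.body {R d} b A.

Section Sides.
Variables (R : realType) (d : nat).
Local Notation C := R[i].

Lemma adjmx_conj (A : 'M[C]_d) : (mxconj A)^t* = mxconj (A^t*).
Proof. by apply/matrixP => i j; rewrite !mxE. Qed.

Lemma mxconjM (A B : 'M[C]_d) : mxconj (A *m B) = mxconj A *m mxconj B.
Proof. by rewrite /mxconj map_mxM. Qed.

Lemma mxconj1 : mxconj (1%:M : 'M[C]_d) = 1%:M.
Proof. by rewrite /mxconj map_mx1. Qed.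

Lemma sideM b (A B : 'M[C]_d) : side b (A *m B) = side b A *m side b B.
Proof. by case: b; rewrite side.unlock tensmx_mul mul1mx // mxconjM. Qed.

Lemma side1 b : side b (1%:M : 'M[C]_d) = 1%:M.
Proof. by case: b; rewrite side.unlock ?mxconj1 tensmx11. Qed.

Lemma side_adj b (A : 'M[C]_d) : (side b A)^t* = side b (A^t*).
Proof.
by case: b; rewrite side.unlock adjmx_tens adjmx1; [rewrite adjmx_conj|].
Qed.

Lemma sideD b (A B : 'M[C]_d) : side b (A + B) = side b A + side b B.
Proof.
by apply/matrixP=> i j; rewrite side.unlock; case: b; rewrite !mxE ?rmorphD; ring.
Qed.

Lemma side0 b : side b (0 : 'M[C]_d) = 0.
Proof.
by apply/matrixP=> i j; rewrite side.unlock; case: b; rewrite !mxE ?rmorph0 ?mulr0 ?mul0r.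
Qed.

Lemma side_sum b I (r : seq I) (P : pred I) (F : I -> 'M[C]_d) :
  side b (\sum_(i <- r | P i) F i) = \sum_(i <- r | P i) side b (F i).
Proof. exact: (big_morph _ (sideD b) (side0 b)). Qed.

End Sides.

Section Family.
Variables (R : realType) (d n : nat) (I : finType) (neg : I -> I).
Local Notation C := R[i].
Local Notation K := ('I_n * (bool * bool))%type.

Lemma big_work (V : nmodType) (F : K -> V) :
  \sum_w F w = \sum_a (F (a, (true, true)) + F (a, (true, false))
                      + (F (a, (false, true)) + F (a, (false, false)))).
Proof.
rewrite (eq_bigr (fun w => F (w.1, w.2))) => [|[]//].
rewrite -(pair_bigA _ (fun a bf => F (a, bf))) /=; apply: eq_bigr => a _.
rewrite (eq_bigr (fun w => F (a, (w.1, w.2)))) => [|[]//].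
by rewrite -(pair_bigA _ (fun b f => F (a, (b, f)))) /= big_bool /= !big_bool.
Qed.

(* An ancilla label holds a transition [i], a coupling [a], the side [b] on which
   the transition acts and the flag [f] rotated by the filter. *)
Definition swap_lbl (k : 'I_(#|I| * #|{: K}|)) : 'I_(#|I| * #|{: K}|) :=
  let: (i, (a, (b, f))) := unlbl k in
  if f then lbl (neg i) (a, (~~ b, true)) else k.

Lemma swap_lblE i a b f : swap_lbl (lbl i (a, (b, f))) =
  if f then lbl (neg i) (a, (~~ b, true)) else lbl i (a, (b, f)).
Proof. by rewrite /swap_lbl lblK. Qed.

Definition swap_mx : 'M[C]_(#|I| * #|{: K}|) :=
  \matrix_(y, x) (x == swap_lbl y)%:R.

Hypothesis negK : involutive neg.

Lemma swap_lblK : involutive swap_lbl.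
Proof.
move=> k; rewrite -[k]unlblK; case: (unlbl k) => i [a [b []]] /=.
  by rewrite !swap_lblE negK negbK.
by rewrite !swap_lblE.
Qed.

Lemma swap_mx_sym : swap_mx^t* = swap_mx.
Proof.
apply/matrixP => x y; rewrite !mxE rmorph_nat; congr (nat_of_bool _)%:R.
by apply/eqP/eqP => ->; rewrite swap_lblK.
Qed.

Lemma swap_mxM : swap_mx *m swap_mx = 1%:M.
Proof.
apply/matrixP => x y; rewrite !mxE (bigD1 (swap_lbl x)) //= big1; last first.
  by move=> z /negPf zx; rewrite !mxE zx mul0r.
by rewrite !mxE eqxx swap_lblK mul1r addr0 eq_sym.
Qed.

Lemma swap_mx_unitary : swap_mx \is unitarymx.
Proof. by apply/unitarymxP; rewrite swap_mx_sym swap_mxM. Qed.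

Variables (w : 'I_n -> R) (J : 'I_n -> I -> 'M[C]_d) (g : 'I_n -> I -> R).
Hypothesis w_ge0 : forall a, 0 <= w a.
Hypothesis w_sum : \sum_a w a = 1.
Hypothesis J_neg : forall a i, J a (neg i) = (J a i)^t*.
Hypothesis J_sum : forall a, \sum_i (J a i)^t* *m J a i = 1%:M.
Hypothesis g_itv : forall a i, 0 <= g a i <= 1.

Local Notation jump_block := (jump_block w J g).

(** The discriminate over an abstract index set, with [neg] in the role of omega |-> - omega. It is
    instantiated both with pointer labels and with the Bohr frequencies themselves. *)
Definition jump_form : 'M[C]_(d * d) :=
  1%:M *t 1%:M + \sum_a (w a)%:C *: \sum_i
    ((Num.sqrt (g a i * g a (neg i)))%:C *: (J a i *t mxconj (J a i))
     - (g a i / 2%:R)%:C *: (((J a i)^t* *m J a i) *t 1%:M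
         + 1%:M *t ((mxconj (J a i))^t* *m mxconj (J a i)))).

Let half_norm a : Num.sqrt (w a / 2) * Num.sqrt (w a / 2) = w a / 2.
Proof. by rewrite -expr2 sqr_sqrtr // divr_ge0. Qed.

Let side_JJ a b i :
  (side b (J a i))^t* *m side b (J a i) = side b ((J a i)^t* *m J a i).
Proof. by rewrite side_adj -sideM. Qed.

(** By [J_neg] the adjoint of the reversed transition is the transition itself, now on the opposite
    side; the product is the same for both values of [b]. *)
Let side_cross a b i :
  (side (~~ b) (J a (neg i)))^t* *m side b (J a i) = J a i *t mxconj (J a i).
Proof.
rewrite side_adj J_neg trmxCK.
by case: b; rewrite side.unlock /= tensmx_mul mulmx1 mul1mx.
Qed.

(** This resolution of the identity serves twice: for the isometry property and for expanding the
    term 1 of the discriminate. *)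
Let sum_weighted : \sum_i \sum_a (w a / 2)%:C *:
    (side true ((J a i)^t* *m J a i) + side false ((J a i)^t* *m J a i))
  = 1%:M :> 'M[C]_(d * d).
Proof.
rewrite exchange_big.
transitivity (\sum_a (w a)%:C *: (1%:M : 'M[C]_(d * d))); last first.
  by rewrite -scaler_suml -rmorph_sum w_sum scale1r.
apply: eq_bigr => a _; rewrite -scaler_sumr big_split -!side_sum J_sum !side1.
by rewrite scalerDr -scalerDl -rmorphD -splitr.
Qed.

Let swapE (T : 'M[C]_(d * d * (#|I| * #|{: K}|), d * d)) k :
  block ((1%:M *t swap_mx) *m T) k = block T (swap_lbl k).
Proof.
rewrite block_tens_mul -[RHS](sum_deltaZ (fun x => block T x)).
by apply: eq_bigr => x _; rewrite mxE mul1mx.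
Qed.

Let jump_block_sqr i a b f :
  (jump_block i a b f)^t* *m jump_block i a b f =
  (w a / 2 * (if f then g a i else 1 - g a i))%:C *: side b ((J a i)^t* *m J a i).
Proof.
rewrite jump_block.unlock adjmxZ -scalemxAl -scalemxAr scalerA side_JJ.
rewrite -rmorphM mulrACA half_norm; congr ((_ * _)%:C *: _).
have [g0 g1] := andP (g_itv a i).
by rewrite -expr2; case: f; rewrite sqr_sqrtr // subr_ge0.
Qed.

Let jump_block_cross i a b :
  (jump_block (neg i) a (~~ b) true)^t* *m jump_block i a b true =
  (w a / 2 * Num.sqrt (g a i * g a (neg i)))%:C *: (J a i *t mxconj (J a i)).
Proof.
rewrite jump_block.unlock adjmxZ -scalemxAl -scalemxAr scalerA side_cross.
have [g0 _] := andP (g_itv a i).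
rewrite -rmorphM mulrACA half_norm sqrtrM //; congr ((_ * _)%:C *: _).
exact: mulrC.
Qed.

(** Unflagged labels are fixed by the swap and contribute w/2 (1 - g) S^dagger S on each side.
    Flagged labels are exchanged in pairs and contribute twice w/2 sqrt(g(i) g(neg i)) times the
    cross term. *)
Lemma jump_block_encoding (T : 'M[C]_(d * d * (#|I| * #|{: K}|), d * d)) :
  (forall i a b f, block T (lbl i (a, (b, f))) = jump_block i a b f) ->
  block_encoding jump_form T (1%:M *t swap_mx).
Proof.
move=> TE.
have Rh : ((1%:M : 'M[C]_(d * d)) *t swap_mx)^t* = 1%:M *t swap_mx.
  by rewrite adjmx_tens adjmx1 swap_mx_sym.
split.
- rewrite /Defs.isometry adjmx_mul_block big_lbl -[RHS]sum_weighted.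
  apply: eq_bigr => i _; rewrite big_work; apply: eq_bigr => a _.
  rewrite !TE.
  rewrite !jump_block_sqr.
  move: (side true _) (side false _) => X Y.
  rewrite -!scalerDl scalerDr -!rmorphD.
  by rewrite -mulrDr (addrC (g a i)) subrK mulr1.
- split; first exact/hermP.
  apply/unitarymxP; rewrite Rh tensmx_mul mul1mx.
  by rewrite swap_mxM tensmx11.
- rewrite -[X in _ *m X *m _]Rh -adjmxM adjmx_mul_block big_lbl /jump_form tensmx11.
  (* Expanding the identity reduces the equation to one for each transition and coupling. *)
  rewrite -[X in X + _]sum_weighted.
  under [X in _ + X]eq_bigr do rewrite scaler_sumr.
  rewrite [X in _ + X]exchange_big -big_split.
  apply: eq_bigr => i _; rewrite big_work -big_split; apply: eq_bigr => a _.
  rewrite -[LHS]/(_ + _) !swapE !swap_lblE !TE.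
  rewrite !jump_block_sqr (jump_block_cross i a true) (jump_block_cross i a false).
  rewrite adjmx_conj -mxconjM side.unlock.
  move: (((J a i)^t* *m J a i) *t 1%:M) => X.
  move: (1%:M *t mxconj ((J a i)^t* *m J a i)) => Y.
  move: (J a i *t mxconj (J a i)) => Z.
  move: (Num.sqrt _) => s.
  (* Halves are made explicit so that the entries satisfy a ring identity without division. *)
  have [h ->] : exists h, w a = 2 * h by exists (w a / 2); field.
  have [k ->] : exists k, g a i = 2 * k by exists (g a i / 2); field.
  rewrite ![2 * _ / 2]mulrAC !divff ?pnatr_eq0 // !mul1r.
  apply/matrixP => x y; rewrite !mxE !(rmorphM, rmorphB, rmorph1, rmorph_nat).
  by rewrite /=; ring.
Qed.

End Family.

(** * Jump operators *)

Section Hamiltonian.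
Variables (R : realType) (d m : nat) (H : hamiltonian R d m).
Local Notation C := R[i].
Local Notation e := (energy H).
Local Notation Pi := (eproj H).

Lemma eproj_adj k : (Pi k)^t* = Pi k.
Proof. exact/hermP/eproj_herm. Qed.

Lemma eproj_fun k f : Pi k *m fun_of_ham H f = (f (e k))%:C *: Pi k.
Proof.
rewrite /fun_of_ham mulmx_sumr (bigD1 k) //= big1 => [|l /negPf lk].
  by rewrite -scalemxAr eproj_mul eqxx addr0.
by rewrite -scalemxAr eproj_mul eq_sym lk scaler0.
Qed.

Lemma fun_eproj k f : fun_of_ham H f *m Pi k = (f (e k))%:C *: Pi k.
Proof.
rewrite /fun_of_ham mulmx_suml (bigD1 k) //= big1 => [|l /negPf lk].
  by rewrite -scalemxAl eproj_mul eqxx addr0.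
by rewrite -scalemxAl eproj_mul lk scaler0.
Qed.

Lemma fun_of_hamM f g :
  fun_of_ham H f *m fun_of_ham H g = fun_of_ham H (fun x => f x * g x).
Proof.
rewrite {1}/fun_of_ham mulmx_suml; apply: eq_bigr => k _.
by rewrite -scalemxAl eproj_fun scalerA -rmorphM.
Qed.

Lemma eq_fun_of_ham f g : f =1 g -> fun_of_ham H f = fun_of_ham H g.
Proof. by move=> fg; apply: eq_bigr => k _; rewrite fg. Qed.

Lemma fun_of_hamZ c f : c%:C *: fun_of_ham H f = fun_of_ham H (fun x => c * f x).
Proof.
by rewrite scaler_sumr; apply: eq_bigr => k _; rewrite scalerA -rmorphM.
Qed.

Lemma fun_of_ham1 : fun_of_ham H (fun=> 1) = 1%:M.
Proof. by rewrite -(eproj_sum H); apply: eq_bigr => k _; rewrite scale1r. Qed.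

Lemma fun_of_ham_adj f : (fun_of_ham H f)^t* = fun_of_ham H f.
Proof. by rewrite adjmx_sum; apply: eq_bigr => k _; rewrite adjmxZ eproj_adj. Qed.

Lemma bohrP w : reflect (exists k l, w = e k - e l) (w \in bohr H).
Proof.
rewrite /bohr mem_undup; apply: (iffP allpairsP) => [[[k l] [_ _ ->]]|[k [l ->]]].
  by exists k, l.
by exists (k, l); rewrite !mem_enum.
Qed.

Lemma bohrN w : w \in bohr H -> - w \in bohr H.
Proof. by move=> /bohrP[k [l ->]]; apply/bohrP; exists l, k; rewrite opprB. Qed.

Lemma bohr_uniq : uniq (bohr H).
Proof. exact: undup_uniq. Qed.

(** The difference of energies partitions the pairs, and [bohr H] is free of repetitions. *)
Lemma sum_bohr (V : nmodType) (F : 'I_m * 'I_m -> V) :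
  \sum_(w <- bohr H) \sum_(kl | e kl.1 - e kl.2 == w) F kl = \sum_kl F kl.
Proof.
under eq_bigr do rewrite big_mkcond; rewrite exchange_big /=.
apply: eq_bigr => kl _.
have klB : e kl.1 - e kl.2 \in bohr H by apply/bohrP; exists kl.1, kl.2.
rewrite (bigD1_seq _ klB bohr_uniq) /= eqxx big1 ?addr0 // => w.
by rewrite eq_sym => /negPf ->.
Qed.

Lemma sum_bohrN (V : nmodType) (F : R -> V) :
  \sum_(w <- bohr H) F (- w) = \sum_(w <- bohr H) F w.
Proof.
rewrite -(big_map -%R predT F); apply: perm_big; apply: uniq_perm.
- by rewrite (map_inj_uniq (@oppr_inj _)) bohr_uniq.
- exact: bohr_uniq.
move=> w; apply/mapP/idP => [[v vB ->]|wB]; first exact: bohrN.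
by exists (- w); rewrite ?opprK ?bohrN.
Qed.

Variable S : 'M[C]_d.
Local Notation jmp := (jump H S).

Lemma jump_adj w : S \is hermsymmx -> (jmp w)^t* = jmp (- w).
Proof.
move=> /hermP Sh; rewrite /jump adjmx_sum.
have swK : involutive (fun p : 'I_m * 'I_m => (p.2, p.1)) by case.
rewrite (reindex_inj (inv_inj swK)) /=; apply: eq_big => [kl|kl _].
  by rewrite -eqr_oppLR opprB.
by rewrite !adjmxM !eproj_adj Sh mulmxA.
Qed.

(** In a term Pi_k S Pi_l, f(H) becomes f(e_l) on the right and f(e_k) on the left. *)
Lemma jump_intertwine w f c :
  (forall k l, e k - e l = w -> f (e l) = c * f (e k)) ->
  jmp w *m fun_of_ham H f = c%:C *: (fun_of_ham H f *m jmp w).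
Proof.
move=> fc; rewrite /jump mulmx_suml mulmx_sumr scaler_sumr.
apply: eq_bigr => -[k l] /= /eqP kl; rewrite -mulmxA eproj_fun (fc _ _ kl).
by rewrite !mulmxA fun_eproj -!scalemxAl -scalemxAr scalerA -rmorphM.
Qed.

(** A cross term survives only for equal left indices; the common frequency then forces equal right
    indices, since the energies are distinct. *)
Lemma jump_adj_mul w : (jmp w)^t* *m jmp w =
  \sum_(kl | e kl.1 - e kl.2 == w) Pi kl.2 *m S^t* *m Pi kl.1 *m S *m Pi kl.2.
Proof.
rewrite /jump adjmx_sum mulmx_suml; apply: eq_bigr => -[k l] /= /eqP kl.
rewrite mulmx_sumr (bigD1 (k, l)) /=; last by rewrite kl.
rewrite big1 => [|[k' l'] /= /andP[/eqP kl' neq]].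
  by rewrite addr0 !adjmxM !eproj_adj !mulmxA -(mulmxA _ (Pi k) (Pi k)) eproj_mul eqxx.
rewrite !adjmxM !eproj_adj !mulmxA -(mulmxA _ (Pi k) (Pi k')) eproj_mul.
have [kk|_] := eqVneq k k'; last by rewrite mulmx0 !mul0mx.
case/negP: neq; rewrite xpair_eqE -kk eqxx /=; apply/eqP/(@energy_inj _ _ _ H).
by move: kl'; rewrite -kl -kk => /addrI /oppr_inj.
Qed.

(** Summing over the inner index first removes the middle projector and leaves Pi_l S^dagger S Pi_l
    = Pi_l. *)
Lemma sum_jump_adj_mul : S^t* *m S = 1%:M ->
  \sum_(w <- bohr H) (jmp w)^t* *m jmp w = 1%:M.
Proof.
move=> SS; under eq_bigr do rewrite jump_adj_mul.
rewrite sum_bohr -(pair_bigA _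
  (fun k l => Pi l *m S^t* *m Pi k *m S *m Pi l)) exchange_big /=.
rewrite -(eproj_sum H); apply: eq_bigr => l _.
rewrite -!mulmx_suml -mulmx_sumr eproj_sum mulmx1 -(mulmxA _ _ S) SS mulmx1.
by rewrite eproj_mul eqxx.
Qed.

End Hamiltonian.

(** * Jump operators over a finite index type of frequencies *)

Section FrequencyIndex.
Variables (R : realType) (d m n : nat) (H : hamiltonian R d m) (beta : R).
Variables (D : davies H beta n) (I : finType) (neg : I -> I).
Variables (isfreq : pred I) (freq : I -> R).
Hypothesis freqE : perm_eq (bohr H) [seq freq i | i <- enum isfreq].
Hypothesis isfreqN : forall i, isfreq (neg i) = isfreq i.
Hypothesis freqN : forall i, isfreq i -> freq (neg i) = - freq i.
Hypothesis refl_coupling : forall a, reflection (coupling D a).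
Hypothesis filter_le1 : forall a w, w \in bohr H -> filterG D a w <= 1.

(** A pointer group may contain labels that are not Bohr frequencies. Zero jumps and filters there
    let all sums run over the whole index type. *)
Definition ijump (a : 'I_n) i :=
  if isfreq i then jump H (coupling D a) (freq i) else 0.
Definition ifilter (a : 'I_n) i := if isfreq i then filterG D a (freq i) else 0.

Lemma freq_bohr i : isfreq i -> freq i \in bohr H.
Proof. by move=> fi; rewrite (perm_mem freqE); apply: map_f; rewrite mem_enum. Qed.

Lemma sum_freq (V : nmodType) (F : R -> V) :
  \sum_(w <- bohr H) F w = \sum_i (if isfreq i then F (freq i) else 0).
Proof. by rewrite (perm_big _ freqE) big_map big_enum /= big_mkcond. Qed.

Lemma ijumpN a i : ijump a (neg i) = (ijump a i)^t*.
Proof.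
rewrite /ijump isfreqN; case: ifP => [fi|_]; last by rewrite adjmx0.
by rewrite jump_adj ?coupling_herm // freqN.
Qed.

Lemma sum_ijump a : \sum_i (ijump a i)^t* *m ijump a i = 1%:M.
Proof.
have [Sh /unitarymxP Su] := refl_coupling a.
rewrite -(sum_jump_adj_mul H (S := coupling D a)); last first.
  by move/hermP: Sh Su => ->.
rewrite sum_freq; apply: eq_bigr => i _; rewrite /ijump.
by case: ifP => // _; rewrite mulmx0.
Qed.

Lemma ifilter_itv a i : 0 <= ifilter a i <= 1.
Proof.
rewrite /ifilter; case: ifP => [/freq_bohr fi|_]; last by rewrite lexx ler01.
by rewrite filter_ge0 // filter_le1.
Qed.

Lemma discriminate_jump_form :
  discriminate D = jump_form neg (weight D) ijump ifilter.
Proof.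
congr (_ + _); apply: eq_bigr => a _; congr (_ *: _); rewrite sum_freq.
apply: eq_bigr => i _; rewrite /ijump /ifilter isfreqN.
case: ifP => [fi|_]; first by rewrite freqN.
by rewrite !mul0r sqrtr0 !(rmorph0 (real_complex R)) !scale0r subrr.
Qed.

Lemma ijump_block_encoding
    (T : 'M[R[i]]_(d * d * (#|I| * #|{: 'I_n * (bool * bool)}|), d * d)) :
  involutive neg ->
  (forall i a b f, block T (lbl i (a, (b, f))) =
     jump_block (weight D) ijump ifilter i a b f) ->
  block_encoding (discriminate D) T (1%:M *t swap_mx R n neg).
Proof.
move=> negK TE; rewrite discriminate_jump_form; apply: jump_block_encoding => //.
- exact: weight_ge0.
- exact: weight_sum.
- exact: ijumpN.
- exact: sum_ijump.
- exact: ifilter_itv.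
Qed.

End FrequencyIndex.

(** * Similarity of the generator and the discriminate *)

Section Vectorization.
Variables (R : realType) (d : nat).
Local Notation C := R[i].

Definition vec (Y : 'M[C]_d) : 'cV[C]_(d * d) :=
  \matrix_(k, _) Y (mxtens_unindex k).1 (mxtens_unindex k).2.

Lemma vecE (Y : 'M[C]_d) i j k : vec Y (mxtens_index (i, j)) k = Y i j.
Proof. by rewrite mxE mxtens_indexK. Qed.

Lemma vec_inj : injective vec.
Proof.
by move=> X Y XY; apply/matrixP => i j; rewrite -(vecE X i j 0) XY vecE.
Qed.

Lemma vec_surj (v : 'cV[C]_(d * d)) : exists Y, v = vec Y.
Proof.
exists (\matrix_(i, j) v (mxtens_index (i, j)) 0).
apply/matrixP => k z; rewrite !mxE -surjective_pairing mxtens_unindexK.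
by rewrite (ord1 z).
Qed.

Lemma vecD X Y : vec (X + Y) = vec X + vec Y.
Proof. by apply/matrixP => k z; rewrite !mxE. Qed.

Lemma vecZ c Y : vec (c *: Y) = c *: vec Y.
Proof. by apply/matrixP => k z; rewrite !mxE. Qed.

Lemma vecB X Y : vec (X - Y) = vec X - vec Y.
Proof. by apply/matrixP => k z; rewrite !mxE. Qed.

Lemma vec0 : vec 0 = 0.
Proof. by apply/matrixP => k z; rewrite !mxE. Qed.

Lemma vec_sum I (r : seq I) (F : I -> 'M[C]_d) :
  vec (\sum_(i <- r) F i) = \sum_(i <- r) vec (F i).
Proof. exact: (big_morph _ vecD vec0). Qed.

Lemma vec_eq0 Y : (vec Y == 0) = (Y == 0).
Proof. by rewrite -vec0 (inj_eq vec_inj). Qed.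

(** With the conjugated factor of the discriminate as [B], the transpose becomes an adjoint, as in
    the generator. *)
Lemma tens_vec (A B : 'M[C]_d) Y : (A *t B) *m vec Y = vec (A *m Y *m B^T).
Proof.
apply/matrixP => k z; rewrite -(mxtens_unindexK k).
case: (mxtens_unindex k) => i j; rewrite vecE !mxE big_mxtens_index.
apply: eq_bigr => y _; rewrite !mxE mulr_suml; apply: eq_bigr => x _.
by rewrite tensmxE vecE; ring.
Qed.

Lemma Omega_vec : Omega R d = vec 1%:M.
Proof.
apply/matrixP => k z; rewrite -(mxtens_unindexK k).
case: (mxtens_unindex k) => i j; rewrite vecE !mxE summxE.
have E (x : 'I_d) : ((delta_mx x 0 : 'cV[C]_d) *t (delta_mx x 0 : 'cV[C]_d))
    (mxtens_index (i, j)) z = (i == x)%:R * (j == x)%:R.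
  have -> : z = mxtens_index (0 : 'I_1, 0 : 'I_1) by rewrite [LHS]ord1; apply: val_inj.
  by rewrite tensmxE !mxE !eqxx !andbT.
under eq_bigr do rewrite E; rewrite (bigD1 i) //= eqxx mul1r big1 ?addr0.
  by rewrite eq_sym.
by move=> x /negPf xi; rewrite eq_sym xi mul0r.
Qed.

Lemma trmx_mxconj (A : 'M[C]_d) : (mxconj A)^T = A^t*.
Proof. by apply/matrixP => i j; rewrite !mxE. Qed.

End Vectorization.

Section Spectrum.
Variables (R : realType) (d m n : nat) (H : hamiltonian R d m) (beta : R).
Variables (D : davies H beta n).
Local Notation C := R[i].
Local Notation e := (energy H).
Local Notation jmp a w := (jump H (coupling D a) w).
Local Notation G := (filterG D).

(* [discriminate D = 1 + sim_gen] under vectorization, and [sim_gen] is the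
   conjugate of [davies_gen D] by [X |-> sigma ^ (1/4) X sigma ^ (1/4)]. *)
Definition sim_gen (Y : 'M[C]_d) : 'M[C]_d :=
  \sum_(a < n) (weight D a)%:C *: \sum_(w <- bohr H)
    ((Num.sqrt (G a w * G a (- w)))%:C *: (jmp a w *m Y *m (jmp a w)^t*)
     - (G a w / 2)%:C *: ((jmp a w)^t* *m jmp a w *m Y
                          + Y *m ((jmp a w)^t* *m jmp a w))).

Lemma discriminate_vec Y : discriminate D *m vec Y = vec (Y + sim_gen Y).
Proof.
rewrite vecD /discriminate tensmx11 mulmxDl mul1mx; congr (_ + _).
rewrite mulmx_suml vec_sum; apply: eq_bigr => a _.
rewrite -scalemxAl vecZ mulmx_suml vec_sum; congr (_ *: _).
apply: eq_bigr => w _; rewrite mulmxBl -!scalemxAl mulmxDl !tens_vec.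
rewrite adjmx_conj -mxconjM !trmx_mxconj adjmxM trmxCK trmx1 mul1mx mulmx1.
by rewrite vecB !vecZ vecD.
Qed.

(** The power sigma^t without its normalisation, which is only a scalar. *)
Definition boltz (t : R) : 'M[C]_d := fun_of_ham H (fun x => expR (- beta * t * x)).

Lemma boltzD s t : boltz s *m boltz t = boltz (s + t).
Proof.
by rewrite fun_of_hamM; apply: eq_fun_of_ham => x; rewrite -expRD; congr expR; ring.
Qed.

Lemma boltz0 : boltz 0 = 1%:M.
Proof.
by rewrite -(fun_of_ham1 H); apply: eq_fun_of_ham => x; rewrite mulr0 mul0r expR0.
Qed.

Lemma boltz_adj t : (boltz t)^t* = boltz t.
Proof. exact: fun_of_ham_adj. Qed.

Lemma boltzK t (X : 'M[C]_d) : boltz (- t) *m (boltz t *m X) = X.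
Proof. by rewrite mulmxA boltzD addNr boltz0 mul1mx. Qed.

Lemma jump_boltz a w t :
  jmp a w *m boltz t = (expR (beta * t * w))%:C *: (boltz t *m jmp a w).
Proof.
apply: jump_intertwine => k l <-; rewrite -expRD; congr expR; ring.
Qed.

Lemma boltz_jump_adj a w t :
  boltz t *m (jmp a w)^t* = (expR (beta * t * w))%:C *: ((jmp a w)^t* *m boltz t).
Proof.
have := congr1 (fun X : 'M[C]_d => X^t*) (jump_boltz a w t).
by rewrite /= adjmxM adjmxZ adjmxM boltz_adj.
Qed.

Lemma jump_sqr_boltz a w t :
  (jmp a w)^t* *m jmp a w *m boltz t = boltz t *m ((jmp a w)^t* *m jmp a w).
Proof.
by rewrite -mulmxA jump_boltz -scalemxAr mulmxA scalemxAl -boltz_jump_adj mulmxA.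
Qed.

(** By detailed balance G(-w) = e^(beta w) G(w), so the product under the root is a perfect
    square. *)
Lemma sqrt_filter a w : w \in bohr H ->
  Num.sqrt (G a w * G a (- w)) = expR (beta * w / 2) * G a w.
Proof.
move=> wB; have db : G a (- w) = expR (beta * w) * G a w.
  by rewrite (filter_db D a wB) mulrA -expRD mulNr subrr expR0 mul1r.
have -> : G a w * G a (- w) = (expR (beta * w / 2) * G a w) ^+ 2.
  have -> : G a (- w) = expR (beta * w / 2) ^+ 2 * G a w.
    by rewrite db expr2 -expRD -splitr.
  by ring.
by rewrite sqrtr_sqr ger0_norm // mulr_ge0 ?expR_ge0 ?filter_ge0.
Qed.

(** Moving sigma^(1/4) out past S on one side and S^dagger on the other yields e^(beta w / 4) twice,
    which is the ratio of sqrt(G(w) G(-w)) to G(w). The anticommutator is unaffected because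
    S^dagger S commutes with sigma. *)
Lemma davies_gen_boltz Y :
  davies_gen D (boltz 4^-1 *m Y *m boltz 4^-1) =
  boltz 4^-1 *m sim_gen Y *m boltz 4^-1.
Proof.
have SB a w := jump_boltz a w 4^-1; have BS a w := boltz_jump_adj a w 4^-1.
have SSB a w := jump_sqr_boltz a w 4^-1.
move: (boltz 4^-1) SB BS SSB => B SB BS SSB; rewrite /davies_gen /sim_gen mulmx_sumr mulmx_suml.
apply: eq_bigr => a _; rewrite -scalemxAr -scalemxAl; congr (_ *: _).
rewrite mulmx_sumr mulmx_suml; apply: eq_big_seq => w wB /=.
rewrite sqrt_filter //.
move: (jmp a w) (SB a w) (BS a w) (SSB a w) => S {}SB {}BS {}SSB.
have h1 : S *m (B *m Y *m B) *m S^t* =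
    (expR (beta * w / 2))%:C *: (B *m (S *m Y *m S^t*) *m B).
  rewrite !mulmxA SB -!scalemxAl -(mulmxA _ B) BS -scalemxAr scalerA -rmorphM.
  rewrite -expRD !mulmxA; congr ((expR _)%:C *: _); by field.
have h2 : S^t* *m S *m (B *m Y *m B) = B *m (S^t* *m S *m Y) *m B.
  by rewrite mulmxA (mulmxA _ B) SSB !mulmxA.
have h3 : B *m Y *m B *m (S^t* *m S) = B *m (Y *m (S^t* *m S)) *m B.
  by rewrite -(mulmxA _ B) -SSB !mulmxA.
rewrite h1 h2 h3 mulmxBr mulmxBl -!scalemxAr -!scalemxAl mulmxDr mulmxDl.
rewrite scalerBr !scalerA -rmorphM mulrC; congr (_ - _ *: _).
by rewrite rmorphM fmorphV rmorph_nat.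
Qed.

(** [davies_gen D] is a bare function; its linearity is what makes [lin_mx] represent it. *)
Lemma davies_gen_linear : linear (davies_gen D).
Proof.
move=> c X Y; rewrite /davies_gen scaler_sumr -big_split; apply: eq_bigr => a _ /=.
rewrite scalerA mulrC -scalerA -scalerDr; congr (_ *: _).
rewrite scaler_sumr -big_split; apply: eq_bigr => w _ /=.
rewrite scalerA [c * _]mulrC -scalerA -scalerDr; congr (_ *: _).
move: (jmp a w) => S; rewrite !(mulmxDr, mulmxDl) -!(scalemxAr, scalemxAl).
move: (S *m X *m _) (S *m Y *m _) (_ *m S *m X) (_ *m S *m Y) => A1 A2 A3 A4.
move: (X *m _) (Y *m _) => A5 A6.
rewrite addrACA -scalerDr [2^-1 *: (_ + _)]scalerDr opprD addrACA.
by rewrite scalerA [_ * c]mulrC -scalerA -scalerBr.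
Qed.

Lemma eigenvalue_davies_gen z :
  eigenvalue (lin_mx (davies_gen D)) z <->
  exists2 X, X != 0 & davies_gen D X = z *: X.
Proof.
pose L : {linear 'M[C]_d -> 'M[C]_d} :=
  HB.pack (davies_gen D) (GRing.isLinear.Build _ _ _ _ _ davies_gen_linear).
have LE X : mxvec X *m lin_mx (davies_gen D) = mxvec (davies_gen D X).
  exact: (mul_vec_lin L X).
split.
  move=> /eigenvalueP[v vL v0]; exists (vec_mx v).
    by rewrite -mxvec_eq0 vec_mxK.
  by apply: (can_inj mxvecK); rewrite -LE vec_mxK vL linearZ /= vec_mxK.
move=> [X X0 LX]; apply/eigenvalueP; exists (mxvec X).
  by rewrite LE LX linearZ.
by rewrite mxvec_eq0.
Qed.

(** Eigenvectors correspond by X = B Y B with B = [boltz 4^-1], inverted by [boltz (- 4^-1)]. *)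
Lemma eigenvalue_gen_discriminate z :
  eigenvalue (lin_mx (davies_gen D)) z <-> eigenvalue (discriminate D) (1 + z).
Proof.
apply: (iff_trans (eigenvalue_davies_gen z)).
apply: iff_trans (iff_sym (eigenvalue_colP _ _)); split.
  move=> [X X0 LX]; pose Y := boltz (- 4^-1) *m X *m boltz (- 4^-1).
  have XE : X = boltz 4^-1 *m Y *m boltz 4^-1.
    by rewrite /Y !mulmxA boltzD subrr boltz0 mul1mx -mulmxA boltzD addNr boltz0 mulmx1.
  exists (vec Y).
    by rewrite vec_eq0; apply: contra_neq X0 => Y0; rewrite XE Y0 mulmx0 mul0mx.
  rewrite discriminate_vec scalerDl scale1r vecD -vecZ; congr (_ + vec _).
  move: LX; rewrite {1}XE davies_gen_boltz {1}XE scalemxAl scalemxAr.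
  move=> /(congr1 (fun X : 'M[C]_d => boltz (- 4^-1) *m X *m boltz (- 4^-1))) /=.
  rewrite -!(mulmxA (boltz 4^-1)) !boltzK -!mulmxA !boltzD subrr boltz0.
  by rewrite !mulmx1.
move=> [v v0]; have [Y vY] := vec_surj v; rewrite {}vY in v0 *.
rewrite discriminate_vec scalerDl scale1r vecD -vecZ => /addrI /vec_inj LY.
exists (boltz 4^-1 *m Y *m boltz 4^-1); last first.
  by rewrite davies_gen_boltz LY -scalemxAr -scalemxAl.
move: v0; rewrite vec_eq0; apply: contra_neq => Y0.
have := congr1 (fun X : 'M[C]_d => boltz (- 4^-1) *m X *m boltz (- 4^-1)) Y0.
rewrite /= -!(mulmxA (boltz 4^-1)) !boltzK -!mulmxA !boltzD subrr boltz0.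
by rewrite !mulmx1 mul0mx mulmx0.
Qed.

End Spectrum.

(** * The Gibbs purification and the spectral gap *)

Section Gibbs.
Variables (R : realType) (d m n : nat) (H : hamiltonian R d m) (beta : R).
Variables (D : davies H beta n).
Hypothesis d_gt0 : (0 < d)%N.
Local Notation C := R[i].
Local Notation e := (energy H).
Local Notation jmp a w := (jump H (coupling D a) w).
Local Notation G := (filterG D).
Local Notation boltz := (boltz H beta).
Local Notation Z := (partition_fun H beta).

Lemma mxtrace_eproj_gt0 k : 0 < \tr (eproj H k).
Proof.
have E : \tr (eproj H k) = \tr ((eproj H k)^t* *m eproj H k).
  by rewrite eproj_adj eproj_mul eqxx.
have nn (i : 'I_d) : true -> 0 <= ((eproj H k)^t* *m eproj H k) i i.
  by rewrite mxE sumr_ge0 // => j _; rewrite !mxE mulrC mul_conjC_ge0.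
rewrite lt_def E sumr_ge0 // andbT; apply: contra_neq (eproj_neq0 H k) => /eqP.
rewrite psumr_eq0 // => /allP E0; apply/matrixP => i j.
have /eqP := E0 j (mem_index_enum _); rewrite mxE => /eqP.
rewrite psumr_eq0 => [/allP/(_ i (mem_index_enum _))|l _].
  by rewrite !mxE mulrC mul_conjC_eq0 => /eqP.
by rewrite !mxE mulrC mul_conjC_ge0.
Qed.

Lemma partition_fun_gt0 : 0 < Z.
Proof.
suff : 0 < \tr (boltzmann H beta) by rewrite ltcE => /andP[].
rewrite /boltzmann /fun_of_ham raddf_sum /=.
have tr_gt0 k : 0 < \tr ((expR (- beta * e k))%:C *: eproj H k).
  by rewrite mxtraceZ pmulr_rgt0 ?mxtrace_eproj_gt0 // ltcR expR_gt0.
(* Without energies the projectors would sum to 0, which differs from 1 in positive dimension. *)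
have [k _] : exists k : 'I_m, True.
  case: (posnP m) => [m0|m_gt0]; last by exists (Ordinal m_gt0).
  have := eproj_sum H; rewrite big1 => [|k]; last first.
    by case: k => k km; suff : (k < 0)%N by []; rewrite -m0.
  move/matrixP/(_ (Ordinal d_gt0) (Ordinal d_gt0)); rewrite !mxE eqxx.
  by move/eqP; rewrite eq_sym oner_eq0.
rewrite (bigD1 k) //= ltr_pwDl ?tr_gt0 // sumr_ge0 // => l _.
by rewrite ltW ?tr_gt0.
Qed.

Lemma gibbs_sqrt_boltz : gibbs_sqrt H beta = (Num.sqrt Z^-1)%:C *: boltz 2^-1.
Proof.
rewrite fun_of_hamZ; apply: eq_fun_of_ham => x.
rewrite mulrC sqrtrM ?expR_ge0 //; last by rewrite invr_ge0 ltW ?partition_fun_gt0.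
have -> : - beta * x = - beta * 2^-1 * x + - beta * 2^-1 * x by field.
by rewrite expRD -expr2 sqrtr_sqr ger0_norm ?expR_ge0 // mulrC.
Qed.

Lemma gibbs_boltz : gibbs H beta = (Z^-1)%:C *: boltz 1.
Proof.
by congr (_ *: _); apply: eq_fun_of_ham => x; rewrite mulr1.
Qed.

Lemma gibbs_purif_vec :
  gibbs_purif H beta = (Num.sqrt Z^-1)%:C *: vec (boltz 2^-1).
Proof.
by rewrite /gibbs_purif Omega_vec tens_vec trmx1 !mulmx1 gibbs_sqrt_boltz vecZ.
Qed.

Lemma sqrt_invZ_neq0 : (Num.sqrt Z^-1)%:C != 0 :> C.
Proof.
by rewrite gt_eqF // ltcR sqrtr_gt0 invr_gt0 partition_fun_gt0.
Qed.

Lemma boltz_neq0 t : boltz t != 0.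
Proof.
apply/eqP => B0; have := boltzD H beta (- t) t.
rewrite B0 mulmx0 addNr boltz0 => /matrixP/(_ (Ordinal d_gt0) (Ordinal d_gt0)).
by rewrite !mxE eqxx => /eqP; rewrite eq_sym oner_eq0.
Qed.

Lemma gibbs_purif_neq0 : gibbs_purif H beta != 0.
Proof.
by rewrite gibbs_purif_vec scaler_eq0 negb_or sqrt_invZ_neq0 vec_eq0 boltz_neq0.
Qed.

(** Detailed balance: the gain term at w equals the loss term at - w, and the differences cancel
    because the set of Bohr frequencies is symmetric. *)
Lemma sim_gen_boltz : sim_gen D (boltz 2^-1) = 0.
Proof.
rewrite /sim_gen big1 // => a _; have Sh := coupling_herm D a.
pose F w := (G a w)%:C *: (boltz 2^-1 *m ((jmp a w)^t* *m jmp a w)).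
suff E : {in bohr H, (fun w =>
    (Num.sqrt (G a w * G a (- w)))%:C *:
      (jmp a w *m boltz 2^-1 *m (jmp a w)^t*)
    - (G a w / 2)%:C *: ((jmp a w)^t* *m jmp a w *m boltz 2^-1
                         + boltz 2^-1 *m ((jmp a w)^t* *m jmp a w)))
    =1 (fun w => F (- w) - F w)}.
  by rewrite (eq_big_seq _ E); clearbody F; rewrite sumrB sum_bohrN subrr scaler0.
move=> w wB; congr (_ - _); last first.
  by rewrite jump_sqr_boltz scalerDr -scalerDl -rmorphD -splitr.
have db : G a (- w) = expR (beta * w) * G a w.
  by rewrite (filter_db D a wB) mulrA -expRD mulNr subrr expR0 mul1r.
rewrite jump_boltz -scalemxAl scalerA -rmorphM /F !jump_adj // opprK.
rewrite mulmxA sqrt_filter // db.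
congr (_%:C *: _); rewrite mulrAC -expRD; congr (expR _ * _).
by field.
Qed.

Lemma discriminate_purif : discriminate D *m gibbs_purif H beta = gibbs_purif H beta.
Proof.
by rewrite gibbs_purif_vec -scalemxAr discriminate_vec sim_gen_boltz addr0.
Qed.

Lemma discriminate_fixed :
  unique_stationary (davies_gen D) (gibbs H beta) ->
  forall z, discriminate D *m z = z -> exists c : C, z = c *: gibbs_purif H beta.
Proof.
move=> uniq z; have [Y ->] := vec_surj z; rewrite discriminate_vec => /vec_inj.
rewrite -[RHS]addr0 => /addrI LY.
have : davies_gen D (boltz 4^-1 *m Y *m boltz 4^-1) = 0.
  by rewrite davies_gen_boltz LY mulmx0 mul0mx.
(* The stationary state carries the factor 1/Z and the purification its square root; the quotient
   corrects for this. *)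
move=> /uniq[c cY]; exists (c * (Z^-1)%:C / (Num.sqrt Z^-1)%:C).
rewrite gibbs_purif_vec scalerA divfK ?sqrt_invZ_neq0 // -vecZ; congr vec.
have := congr1 (fun X : 'M[C]_d => boltz (- 4^-1) *m X *m boltz (- 4^-1)) cY.
rewrite /= -!(mulmxA (boltz 4^-1)) !boltzK -!mulmxA !boltzD subrr boltz0.
rewrite mulmx1 => ->; rewrite gibbs_boltz scalerA -scalemxAl -scalemxAr !boltzD.
by congr (_ *: boltz _); field.
Qed.

Hypothesis eig_itv : forall z, eigenvalue (discriminate D) z -> -1 <= z <= 1.

Lemma eigenvalue_davies_gen_itv z : eigenvalue (lin_mx (davies_gen D)) z ->
  exists2 r : R, z = r%:C & - 2 <= r <= 0.
Proof.
move=> /eigenvalue_gen_discriminate/eig_itv.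
case: z => x y; rewrite !lecE /= => /andP[/andP[/eqP y0 x1] /andP[_ x2]].
exists x; first by apply/eqP; rewrite eq_complex /= eqxx /=; apply/eqP; lra.
by apply/andP; split; lra.
Qed.

Lemma spectral_gap_le (l : R) : eigenvalue (discriminate D) l%:C -> l != 1 ->
  spectral_gap (davies_gen D) <= 1 - l.
Proof.
move=> ql l1; apply: ge_inf.
  (* The infimum is bounded below because the spectrum is nonpositive. *)
  by exists 0 => _ [z [/eigenvalue_davies_gen_itv[r -> /andP[_ r0]] _] <-]; rewrite oppr_ge0.
exists (l - 1)%:C; last by rewrite /= opprB.
split; last by rewrite -(rmorph0 (real_complex R)) (inj_eq (@complexI _)) subr_eq0.
by apply/eigenvalue_gen_discriminate; rewrite rmorphB rmorph1 addrC subrK.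
Qed.

(** A positive gap excludes the empty spectrum, whose infimum is 0 by convention. *)
Lemma spectral_gap_ex : 0 < spectral_gap (davies_gen D) ->
  exists2 l : R, eigenvalue (discriminate D) l%:C & l != 1.
Proof.
rewrite /spectral_gap; set A := [set _ | _ in _]%classic.
have [->|/set0P[_ [z [zL z0] _]] _] := eqVneq A set0; first by rewrite inf0 ltxx.
have [r rz _] := eigenvalue_davies_gen_itv zL; exists (1 + r).
  have -> : (1 + r)%:C = 1 + z by rewrite rz rmorphD rmorph1.
  exact: (eigenvalue_gen_discriminate D z).1 zL.
by apply: contra_neq z0; rewrite rz -[X in _ = X]addr0 => /addrI ->.
Qed.

Lemma spectral_gap_le2 : spectral_gap (davies_gen D) <= 2%:R.
Proof.
have [|/spectral_gap_ex[l ql l1]] := leP (spectral_gap (davies_gen D)) 0.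
  by move/le_trans; apply.
apply: le_trans (spectral_gap_le ql l1) _.
have := eig_itv ql; rewrite -(rmorphN1 (real_complex R)) lecR => /andP[+ _]; lra.
Qed.

Lemma discriminate_phase_gap N (T : 'M[C]_(N, d * d)) Rf :
  block_encoding (discriminate D) T Rf ->
  Num.sqrt (spectral_gap (davies_gen D)) <= phase_gap (walk T Rf).
Proof.
move=> be; apply: (sqrt_le_phase_gap be).
- exact: spectral_gap_le2.
- exact: spectral_gap_le.
- exact: spectral_gap_ex.
Qed.

End Gibbs.

(** * Circuits with energy estimation *)

Section PointerFrequencies.
Variables (R : realType) (d m : nat) (H : hamiltonian R d m) (P : pointer H).
Local Notation e := (energy H).

(** The sign is the one left by the circuit: a transition from [l] to [k] writes minus its Bohr
    frequency. *)
Definition pointer_of (kl : 'I_m * 'I_m) : P := label P kl.2 - label P kl.1.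
Definition pointer_isfreq (p : P) := [exists kl, pointer_of kl == p].
(** All pairs with the same label have the same energy difference by [pointer_of_eq], so the choice
    is harmless; 0 is a default off the frequencies. *)
Definition pointer_freq (p : P) : R :=
  if [pick kl | pointer_of kl == p] is Some kl then e kl.1 - e kl.2 else 0.

Lemma pointer_of_eq kl kl' :
  (pointer_of kl == pointer_of kl') = (e kl.1 - e kl.2 == e kl'.1 - e kl'.2).
Proof.
rewrite -(inj_eq (@oppr_inj _)) -[RHS](inj_eq (@oppr_inj _)) !opprB.
apply/eqP/eqP => [E|E]; have := label_exact P kl.1 kl.2 kl'.1 kl'.2.
  by case=> /(_ E) E' _; rewrite -opprB E' opprB.
by case=> _; apply; rewrite -opprB E opprB.
Qed.

Lemma pointer_freqE kl p : pointer_isfreq p ->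
  (pointer_of kl == p) = (e kl.1 - e kl.2 == pointer_freq p).
Proof.
move=> /existsP[kl' kl'p]; rewrite /pointer_freq; case: pickP => [kl2 /eqP <-|].
  exact: pointer_of_eq.
by move=> /(_ kl'); rewrite kl'p.
Qed.

Lemma pointer_of_freq kl : pointer_freq (pointer_of kl) = e kl.1 - e kl.2.
Proof.
apply/esym/eqP; rewrite -pointer_freqE //.
by apply/existsP; exists kl.
Qed.

Lemma pointer_freq_perm :
  perm_eq (bohr H) [seq pointer_freq p | p <- enum pointer_isfreq].
Proof.
have enumE p : (p \in enum pointer_isfreq) = [exists kl, pointer_of kl == p].
  by rewrite mem_enum.
apply: uniq_perm; first exact: bohr_uniq.
  rewrite map_inj_in_uniq ?enum_uniq // => p q.
  rewrite !enumE => /existsP[kl /eqP<-] /existsP[kl' /eqP<-].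
  by rewrite !pointer_of_freq => /eqP; rewrite -pointer_of_eq => /eqP.
move=> w; apply/bohrP/mapP => [[k [l ->]]|[p]].
  exists (pointer_of (k, l)); last by rewrite pointer_of_freq.
  by rewrite enumE; apply/existsP; exists (k, l).
rewrite enumE => /existsP[[k l] /eqP<-] ->; exists k, l.
by rewrite pointer_of_freq.
Qed.

Lemma pointer_ofN k l : pointer_of (l, k) = - pointer_of (k, l).
Proof. by rewrite /pointer_of opprB. Qed.

Lemma pointer_isfreqN p : pointer_isfreq (- p) = pointer_isfreq p.
Proof.
suff h q : pointer_isfreq q -> pointer_isfreq (- q).
  by apply/idP/idP => /h //; rewrite opprK.
by move=> /existsP[[k l] /eqP<-]; apply/existsP; exists (l, k); rewrite pointer_ofN.
Qed.

Lemma pointer_freqN p : pointer_isfreq p -> pointer_freq (- p) = - pointer_freq p.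
Proof.
by move=> /existsP[[k l] /eqP<-]; rewrite -pointer_ofN !pointer_of_freq opprB.
Qed.

End PointerFrequencies.

(** * Energy estimation and controlled couplings, block by block *)

Section Circuit.
Variables (R : realType) (d m n : nat) (H : hamiltonian R d m) (beta : R).
Variables (D : davies H beta n) (P : pointer H).
Local Notation C := R[i].
Local Notation K := ('I_n * (bool * bool))%type.
Local Notation a := #|{: K}|.
Local Notation N := (#|P| * a)%N.
Local Notation Pi := (eproj H).
Local Notation impl := (@implementable R d m n H beta D P a).
Local Notation pjump := (ijump D (@pointer_isfreq _ _ _ _ P) (@pointer_freq _ _ _ _ P)).

Lemma pjumpE j p : pjump j p =
  \sum_(kl | pointer_of P kl == p) Pi kl.1 *m coupling D j *m Pi kl.2.
Proof.
rewrite /ijump; case: ifP => [fp|fp].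
  by apply: eq_bigl => kl; rewrite pointer_freqE.
rewrite big1 // => kl klp; suff : pointer_isfreq p by rewrite fp.
by apply/existsP; exists kl.
Qed.

Definition est (b : bool) : 'M[C]_(d * d * N) :=
  \sum_(p : P) \sum_k side b (Pi k) *t (pointer_shift k p *t 1%:M).

Lemma impl_energy_est b : impl (est b).
Proof.
case: b; last by rewrite /est side.unlock; exact: impl_est.
by rewrite /est side.unlock; exact: impl_est_conj.
Qed.

Lemma block_pointer_op (A : 'M[C]_(d * d)) (X : 'M[C]_#|P|)
    (M : 'M[C]_(d * d * N, d * d)) (p : P) (w : K) :
  block ((A *t (X *t (1%:M : 'M_a))) *m M) (lbl p w) =
  \sum_(q : P) X (enum_rank p) (enum_rank q) *: (A *m block M (lbl q w)).
Proof.
rewrite block_tens_mul big_lbl; apply: eq_bigr => q _.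
rewrite -[RHS](sum_deltaZ (fun v => X (enum_rank p) (enum_rank q) *:
  (A *m block M (lbl q v)))).
apply: eq_bigr => v _; rewrite scalerA; congr (_ *: _).
rewrite /lbl tensmxE !mxE mulrC (inj_eq enum_rank_inj) eq_sym.
by congr ((nat_of_bool _)%:R * _).
Qed.

Lemma pointer_shiftE k (p' p q : P) :
  pointer_shift k p' (enum_rank p) (enum_rank q) =
  (p' == p + label P k)%:R * (q == p')%:R :> C.
Proof.
rewrite mxE !(inj_eq enum_rank_inj) -natrM mulnb.
by rewrite [p == _]eq_sym subr_eq.
Qed.

Lemma block_est b (M : 'M[C]_(d * d * N, d * d)) p w :
  block (est b *m M) (lbl p w) =
  \sum_k side b (Pi k) *m block M (lbl (p + label P k) w).
Proof.
rewrite /est exchange_big mulmx_suml block_sum; apply: eq_bigr => k _.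
rewrite mulmx_suml block_sum.
rewrite -[RHS](sum_deltaZ (fun q => side b (Pi k) *m block M (lbl q w))).
apply: eq_bigr => p' _; rewrite block_pointer_op.
rewrite -[in RHS](sum_deltaZ (fun q => side b (Pi k) *m block M (lbl q w)) p').
rewrite scaler_sumr; apply: eq_bigr => q _.
by rewrite pointer_shiftE scalerA.
Qed.

Lemma block_est_adj b (M : 'M[C]_(d * d * N, d * d)) p w :
  block ((est b)^t* *m M) (lbl p w) =
  \sum_k side b (Pi k) *m block M (lbl (p - label P k) w).
Proof.
have -> : (est b)^t* = \sum_k \sum_(p : P)
    side b (Pi k) *t ((pointer_shift k p)^t* *t (1%:M : 'M_a)).
  rewrite /est exchange_big adjmx_sum; apply: eq_bigr => k _.
  rewrite adjmx_sum; apply: eq_bigr => q _.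
  by rewrite !adjmx_tens adjmx1 side_adj eproj_adj.
rewrite mulmx_suml block_sum; apply: eq_bigr => k _.
rewrite mulmx_suml block_sum.
rewrite -[RHS](sum_deltaZ (fun p' => side b (Pi k) *m
  block M (lbl (p' - label P k) w))).
apply: eq_bigr => p' _; rewrite block_pointer_op.
rewrite -[in RHS](sum_deltaZ (fun q => side b (Pi k) *m block M (lbl q w))
  (p' - label P k)).
rewrite scaler_sumr; apply: eq_bigr => q _.
rewrite !mxE -/(pointer_shift k p') -/(pointer_shift k p' _ _).
have := pointer_shiftE k p' q p; rewrite mxE => ->.
rewrite scalerA rmorphM !rmorph_nat mulrC; congr (_ * _ *: _).
  by rewrite eq_sym.
by rewrite -subr_eq eq_sym.
Qed.

Definition work_pred (j : 'I_n) (b : bool) (y : 'I_N) : bool :=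
  let: (_, (j', (b', _))) := unlbl y in (j' == j) && (b' == b).

Lemma impl_controlled j b :
  impl (controlled (side b (coupling D j))
          (\matrix_(x, y) ((x == y) && work_pred j b x)%:R)).
Proof.
set E := \matrix_(x, y) _.
have Eh : E \is hermsymmx.
  apply/hermP; apply/matrixP => x y; rewrite !mxE rmorph_nat eq_sym.
  by case: (x =P y) => // ->.
have EE : E *m E = E.
  apply/matrixP => x y; rewrite !mxE (bigD1 x) //= big1 => [|z /negPf zx].
    rewrite !mxE eqxx addr0 /=; case: (work_pred j b x); first by rewrite mul1r.
    by rewrite andbF mul0r.
  by rewrite !mxE eq_sym zx mul0r.
by rewrite side.unlock; case: b @E Eh EE => E Eh EE;
  [exact: impl_coupling_conj|exact: impl_coupling].
Qed.

(** The operator is a product of controlled couplings, built along the enumeration of the indices.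
    As the enumeration has no repetition, each label triggers at most one factor. *)
Lemma impl_controlled_couplings b : exists2 U, impl U &
  forall (M : 'M[C]_(d * d * N, d * d)) p j b' f,
  block (U *m M) (lbl p (j, (b', f))) =
  (if b' == b then side b (coupling D j) else 1%:M)
    *m block M (lbl p (j, (b', f))).
Proof.
suff [U Ui UE] : exists2 U, impl U &
    forall (M : 'M[C]_(d * d * N, d * d)) p j b' f,
    block (U *m M) (lbl p (j, (b', f))) =
    (if (j \in enum 'I_n) && (b' == b) then side b (coupling D j) else 1%:M)
      *m block M (lbl p (j, (b', f))).
  by exists U => // M p j b' f; rewrite UE mem_enum.
elim: (enum 'I_n) (enum_uniq 'I_n) => [_|j0 s IHs /= /andP[j0s /IHs[U Ui UE]]].
  exists (1%:M *t 1%:M).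
    by apply: impl_ancilla; apply/unitarymxP; rewrite adjmx1 mulmx1.
  by move=> M p j b' f; rewrite tensmx11 !mul1mx.
exists (controlled (side b (coupling D j0))
          (\matrix_(x, y) ((x == y) && work_pred j0 b x)%:R) *m U).
  by apply: impl_mul => //; exact: impl_controlled.
move=> M p j b' f; rewrite -mulmxA (block_controlled _ _ (c := work_pred j0 b)) //.
rewrite UE mulmxA; congr (_ *m _); rewrite /work_pred lblK in_cons.
have [->|_] := eqVneq j j0; last by rewrite mul1mx.
by rewrite (negPf j0s) /= mulmx1.
Qed.

(* Conjugating the couplings by energy estimation writes the label of minus
   the Bohr frequency of the transition into the pointer. *)
Lemma impl_stage b : exists2 U, impl U &
  forall (M : 'M[C]_(d * d * N, d * d)) p j b' f,
  block (U *m M) (lbl p (j, (b', f))) =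
  if b' == b then \sum_(kl : 'I_m * 'I_m)
      side b (Pi kl.1 *m coupling D j *m Pi kl.2) *m
        block M (lbl (p - pointer_of P kl) (j, (b', f)))
  else block M (lbl p (j, (b', f))).
Proof.
have [U Ui UE] := impl_controlled_couplings b.
exists (est b *m U *m (est b)^t*).
  by apply: impl_mul; [apply: impl_mul => //|apply: impl_adj];
    exact: impl_energy_est.
move=> M p j b' f; rewrite -!mulmxA block_est.
under eq_bigr do rewrite UE block_est_adj.
case: eqP => _.
  rewrite -(pair_bigA _ (fun k l => side b (Pi k *m coupling D j *m Pi l) *m
    block M (lbl (p - pointer_of P (k, l)) (j, (b', f))))) /=.
  apply: eq_bigr => k _; rewrite !mulmx_sumr; apply: eq_bigr => l _.
  by rewrite !sideM -!mulmxA /pointer_of opprB addrA.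
(* On the other side no coupling separates the two energy estimations, so orthogonality of the
   projectors makes their pointer shifts cancel. *)
transitivity (\sum_k side b (Pi k) *m block M (lbl p (j, (b', f)))).
  apply: eq_bigr => k _; rewrite mul1mx mulmx_sumr (bigD1 k) // big1.
    by rewrite [LHS]addr0 mulmxA -sideM eproj_mul eqxx addrK.
  by move=> l /negPf lk; rewrite mulmxA -sideM eproj_mul eq_sym lk side0 mul0mx.
by rewrite -mulmx_suml -side_sum eproj_sum side1 mul1mx.
Qed.

End Circuit.

Section Householder.
Variables (R : realType) (N : nat).
Local Notation C := R[i].

(* The Householder reflection exchanging [e_j] and [chi]. *)
Lemma unitary_col_orth (chi : 'cV[C]_N) (j : 'I_N) :
  chi^t* *m chi = 1%:M -> chi j 0 = 0 ->
  exists2 V : 'M[C]_N, V \is unitarymx & forall y, V y j = chi y 0.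
Proof.
move=> chi1 chij; pose e : 'cV[C]_N := delta_mx j 0; pose u := e - chi.
have eE : e^t* = delta_mx 0 j by rewrite /e trmx_delta map_delta_mx.
have ee : e^t* *m e = 1%:M.
  by rewrite eE mul_delta_mx; apply/matrixP => x y; rewrite !mxE !ord1.
have echi : e^t* *m chi = 0.
  by rewrite eE -rowE; apply/matrixP => x y; rewrite !mxE !ord1 chij.
have chie : chi^t* *m e = 0 by rewrite -[LHS]trmxCK adjmxM trmxCK echi adjmx0.
have ue : u^t* *m e = 1%:M by rewrite /u adjmxB mulmxBl ee chie subr0.
have uu : u^t* *m u = 2%:R *: 1%:M.
  rewrite /u adjmxB mulmxBl !mulmxBr ee echi chie chi1 subr0 sub0r opprK.
  by rewrite scaler_nat.
(* The usual factor 2 / |u|^2 is 1, since [e] and [chi] are orthonormal. *)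
pose V := 1%:M - u *m u^t*.
have Vh : V^t* = V by rewrite /V adjmxB adjmx1 adjmxM trmxCK.
exists V.
  apply/unitarymxP; rewrite Vh /V mulmxBl mul1mx mulmxBr mulmx1.
  rewrite mulmxA -(mulmxA u) uu -scalemxAr mulmx1 -scalemxAl scaler_nat mulr2n.
  by rewrite opprB addrK subrK.
move=> y; have Ve : V *m e = chi.
  by rewrite /V mulmxBl mul1mx -mulmxA ue mulmx1 /u opprB addrC subrK.
by rewrite -Ve /e -colE [RHS]mxE.
Qed.

End Householder.

(** * Rotation of the flag by the filter *)

Section Rotation.
Variables (R : realType) (n : nat) (I : finType) (g : 'I_n -> I -> R).
Local Notation C := R[i].
Local Notation K := ('I_n * (bool * bool))%type.
Hypothesis g_itv : forall a i, 0 <= g a i <= 1.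

(** A symmetric orthogonal matrix is chosen, so that [rot_mx] is self-adjoint and its unitarity
    reduces to its square. *)
Definition rot_coef (x : R) (f f' : bool) : R :=
  match f, f' with
  | false, false => Num.sqrt (1 - x)
  | true, true => - Num.sqrt (1 - x)
  | _, _ => Num.sqrt x
  end.

Definition rot_mx : 'M[C]_(#|I| * #|{: K}|) := \matrix_(y, x)
  let: (p, (a, (b, f))) := unlbl y in
  \sum_f' (x == lbl p (a, (b, f')))%:R * (rot_coef (g a p) f f')%:C.

Lemma rot_mx_sum (V : lmodType C) (F : 'I_(#|I| * #|{: K}|) -> V) p a b f :
  \sum_x rot_mx (lbl p (a, (b, f))) x *: F x =
  \sum_f' (rot_coef (g a p) f f')%:C *: F (lbl p (a, (b, f'))).
Proof.
under eq_bigr do rewrite mxE lblK scaler_suml.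
rewrite exchange_big; apply: eq_bigr => f' _.
rewrite -[F (lbl _ _)]sum_deltaZ scaler_sumr; apply: eq_bigr => x _.
by rewrite !scalerA mulrC.
Qed.

Lemma rot_mxE p a b f p' a' b' f' :
  rot_mx (lbl p (a, (b, f))) (lbl p' (a', (b', f'))) =
  [&& p' == p, a' == a & b' == b]%:R * (rot_coef (g a p) f f')%:C.
Proof.
rewrite mxE lblK (bigD1 f') //= big1 => [|x /negPf xf].
  by rewrite addr0 lbl_eq !xpair_eqE eqxx andbT.
by rewrite lbl_eq !xpair_eqE [f' == x]eq_sym xf !andbF mul0r.
Qed.

Lemma rot_mx_adj : rot_mx^t* = rot_mx.
Proof.
apply/matrixP => y x; rewrite !mxE -/(rot_mx x y) -[y]unlblK -[x]unlblK.
case: (unlbl y) (unlbl x) => [p [a [b f]]] [p' [a' [b' f']]] /=.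
have := rot_mxE p a b f p' a' b' f'; have := rot_mxE p' a' b' f' p a b f.
rewrite !mxE => -> ->; rewrite rmorphM rmorph_nat.
rewrite (eq_sym p) (eq_sym a) (eq_sym b).
case: eqP => [->|]; last by rewrite !mul0r.
case: eqP => [->|]; last by rewrite !mul0r.
congr (_ * _); rewrite [LHS]conjc_real; congr (_%:C).
by case: f f' => [] [].
Qed.

Lemma rot_coef_sqr x f f' : 0 <= x <= 1 ->
  \sum_h rot_coef x f h * rot_coef x h f' = (f' == f)%:R.
Proof.
move=> /andP[x0 x1]; rewrite big_bool.
have s1 : Num.sqrt x * Num.sqrt x = x by rewrite -expr2 sqr_sqrtr.
have s2 : Num.sqrt (1 - x) * Num.sqrt (1 - x) = 1 - x.
  by rewrite -expr2 sqr_sqrtr // subr_ge0.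
by case: f f' => [] [] /=; rewrite ?mulrNN ?mulrN ?mulNr ?s1 ?s2; ring.
Qed.

Lemma rot_mx_unitary : rot_mx \is unitarymx.
Proof.
apply/unitarymxP; rewrite rot_mx_adj; apply/matrixP => y x; rewrite !mxE.
rewrite -[y]unlblK -[x]unlblK.
case: (unlbl y) (unlbl x) => [p [a [b f]]] [p' [a' [b' f']]] /=.
rewrite (rot_mx_sum (fun z => rot_mx z (lbl p' (a', (b', f'))) : C^o)).
under eq_bigr do rewrite rot_mxE [_%:R * _]mulrC scalerA -rmorphM /=.
rewrite -scaler_suml -rmorph_sum rot_coef_sqr // rmorph_nat.
rewrite lbl_eq !xpair_eqE.
by rewrite [LHS]mulrC -natrM mulnb -!andbA !(eq_sym p) (eq_sym a) (eq_sym b) (eq_sym f).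
Qed.

End Rotation.

(** * The block encoding as a circuit *)

Section CircuitEncoding.
Variables (R : realType) (d m n : nat) (H : hamiltonian R d m) (beta : R).
Variables (D : davies H beta n) (P : pointer H).
Local Notation C := R[i].
Local Notation K := ('I_n * (bool * bool))%type.
Local Notation N := (#|P| * #|{: K}|)%N.
Local Notation w := (weight D).
Local Notation isf := (@pointer_isfreq _ _ _ _ P).
Local Notation frq := (@pointer_freq _ _ _ _ P).
Local Notation impl := (@implementable R d m n H beta D P #|{: K}|).
Hypothesis refl_coupling : forall a, reflection (coupling D a).
Hypothesis filter_le1 : forall a w, w \in bohr H -> filterG D a w <= 1.

Definition prep_amp (y : 'I_N) : C :=
  let: (p, (a, (b, f))) := unlbl y in
  ((p == 0) && ~~ f)%:R * (Num.sqrt (w a / 2))%:C.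

Lemma prep_ampE p a b f : prep_amp (lbl p (a, (b, f))) =
  ((p == 0) && ~~ f)%:R * (Num.sqrt (w a / 2))%:C.
Proof. by rewrite /prep_amp lblK. Qed.

Lemma prep_amp_eq0 p a b f : (p != 0) || f -> prep_amp (lbl p (a, (b, f))) = 0.
Proof. by rewrite prep_ampE; case: eqP; case: f => //= *; rewrite mul0r. Qed.

Lemma impl_prep : exists2 V : 'M[C]_N, V \is unitarymx &
  exists j, forall y, V y j = prep_amp y.
Proof.
have [a0] : exists a0 : 'I_n, True.
  case: (posnP n) => [n0|n_gt0]; last by exists (Ordinal n_gt0).
  have := weight_sum D; rewrite big1 => [/eqP|[k kn]].
    by rewrite eq_sym oner_eq0.
  by suff : (k < 0)%N by []; rewrite -n0.
move=> _; pose chi : 'cV[C]_N := \col_y prep_amp y.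
have chi1 : chi^t* *m chi = 1%:M.
  apply/matrixP => x y; rewrite !ord1 !mxE eqxx big_lbl (bigD1 0) //=.
  rewrite [X in _ + X]big1 ?addr0 => [|p /negPf p0]; last first.
    apply: big1 => -[a [b f]] _.
    by rewrite !mxE prep_amp_eq0 ?p0 // mulr0.
  rewrite big_work -(rmorph1 (real_complex R)) -(weight_sum D) rmorph_sum.
  apply: eq_bigr => a _; rewrite !mxE.
  rewrite ![prep_amp (lbl _ (a, (_, true)))]prep_amp_eq0 ?orbT // !mulr0 !add0r.
  rewrite !prep_ampE eqxx !mul1r.
  have -> : Num.conj (Num.sqrt (w a / 2))%:C = (Num.sqrt (w a / 2))%:C.
    exact: conjc_real.
  rewrite -rmorphM -expr2 sqr_sqrtr ?divr_ge0 ?weight_ge0 //.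
  by rewrite -rmorphD -splitr.
(* The starting label has its flag set, where the prepared state has amplitude 0, as the Householder
   reflection requires. *)
have [|V Vu VE] := unitary_col_orth (j := lbl 0 (a0, (false, true))) chi1.
  by rewrite mxE prep_amp_eq0 ?orbT.
exists V => //; exists (lbl 0 (a0, (false, true))) => y.
by rewrite VE mxE.
Qed.

(** Four stages: preparation of coupling and side, transitions on the system, transitions on the
    conjugate system, and rotation of the flag. *)
Lemma pointer_circuit : exists U j, impl U /\ forall p a b f,
  block (U *m attach R (d * d) j) (lbl p (a, (b, f))) =
  jump_block w (ijump D isf frq) (ifilter D isf frq) p a b f.
Proof.
have [V Vu [j VE]] := impl_prep.
have [U0 U0i U0E] := impl_stage D P false.
have [U1 U1i U1E] := impl_stage D P true.
have g_itv a p : 0 <= ifilter D isf frq a p <= 1.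
  exact: (ifilter_itv (pointer_freq_perm P)).
exists ((1%:M *t rot_mx (ifilter D isf frq)) *m (U1 *m (U0 *m (1%:M *t V)))), j.
split.
  apply: impl_mul; first by apply: impl_ancilla; exact: rot_mx_unitary.
  by apply: impl_mul => //; apply: impl_mul => //; exact: impl_ancilla.
pose M0 : 'M[C]_(d * d * N, d * d) := (1%:M *t V) *m attach R (d * d) j.
have M0E y : block M0 y = prep_amp y *: 1%:M.
  rewrite block_tens_mul -VE -[RHS](sum_deltaZ (fun x => V y x *: 1%:M)).
  by apply: eq_bigr => x _; rewrite block_attach mul1mx !scalerA mulrC.
have U1U0E p a b f : block (U1 *m (U0 *m M0)) (lbl p (a, (b, f))) =
    ((~~ f)%:R * (Num.sqrt (w a / 2))%:C) *: side b (ijump D isf frq a p).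
  have -> : block (U1 *m (U0 *m M0)) (lbl p (a, (b, f))) =
      \sum_kl side b (eproj H kl.1 *m coupling D a *m eproj H kl.2) *m
        block M0 (lbl (p - pointer_of P kl) (a, (b, f))).
    rewrite U1E; case: b => /=; last by rewrite U0E.
    by apply: eq_bigr => kl _; rewrite U0E.
  rewrite pjumpE side_sum scaler_sumr [RHS]big_mkcond /=; apply: eq_bigr => kl _.
  (* The pointer starts at 0, so only transitions labelled [p] reach the block at [p]. *)
  rewrite M0E prep_ampE subr_eq0 eq_sym; case: eqP => _ /=.
    by rewrite -scalemxAr mulmx1.
  by rewrite mul0r scale0r mulmx0.
move=> p a b f; rewrite -!mulmxA -/M0 block_tens_mul.
under eq_bigr do rewrite mul1mx.
(* Before the rotation the flag is unset, so only the column [false] of the rotation enters. *)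
rewrite (rot_mx_sum _ (fun x => block (U1 *m (U0 *m M0)) x)) big_bool.
rewrite !U1U0E /= mul0r scale0r scaler0 mul1r scalerA -rmorphM jump_block.unlock.
by rewrite [LHS]add0r mulrC; case: f.
Qed.

Lemma pointer_block_encoding :
  exists (T : 'M[C]_(d * d * N, d * d)) (Rf : 'M[C]_(d * d * N)),
    block_encoding (discriminate D) T Rf /\
    implementable_block_encoding D T Rf.
Proof.
have [U [j [Ui UE]]] := pointer_circuit.
exists (U *m attach R (d * d) j), (1%:M *t swap_mx R n (-%R : P -> P)).
have negK : involutive (-%R : P -> P) by exact: opprK.
split; last first.
  split; last by exists U, j.
  by apply: impl_ancilla; exact: swap_mx_unitary.
apply: (ijump_block_encoding (pointer_freq_perm P)) => //.
- exact: pointer_isfreqN.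
- exact: pointer_freqN.
Qed.

End CircuitEncoding.

(** * Walks of the discriminate *)

Section BohrFrequencies.
Variables (R : realType) (d m n : nat) (H : hamiltonian R d m) (beta : R).
Variables (D : davies H beta n).
Local Notation C := R[i].
Hypothesis refl_coupling : forall a, reflection (coupling D a).
Hypothesis filter_le1 : forall a w, w \in bohr H -> filterG D a w <= 1.
Local Notation I := (seq_sub (bohr H)).

Definition bohr_neg (w : I) : I := SeqSub (bohrN (ssvalP w)).

Lemma bohr_freq_perm : perm_eq (bohr H) [seq ssval w | w <- enum (predT : pred I)].
Proof.
apply: uniq_perm; first exact: bohr_uniq.
  by rewrite (map_inj_uniq val_inj) enum_uniq.
move=> w; apply/idP/mapP => [wB|[v _ ->]]; last exact: ssvalP.
by exists (SeqSub wB); rewrite ?mem_enum.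
Qed.

(** The isometry is written down by its blocks, without a circuit, so no pointer is assumed. Its
    existence bounds the spectrum of the discriminate. *)
Lemma bohr_block_encoding : exists N (T : 'M[C]_(N, d * d)) (Rf : 'M[C]_N),
  block_encoding (discriminate D) T Rf.
Proof.
pose K := ('I_n * (bool * bool))%type.
pose J := ijump D predT (fun w : I => ssval w).
pose g := ifilter D predT (fun w : I => ssval w).
pose T : 'M[C]_(d * d * (#|{: I}| * #|{: K}|), d * d) := \matrix_(x, y)
  let: (w, (a, (b, f))) := unlbl (mxtens_unindex x).2 in
  jump_block (weight D) J g w a b f (mxtens_unindex x).1 y.
exists _, T, (1%:M *t swap_mx R n bohr_neg).
apply: (ijump_block_encoding bohr_freq_perm) => //.
- by move=> w; apply: val_inj; rewrite /= opprK.
- by move=> w a b f; apply/matrixP => x y; rewrite !mxE mxtens_indexK lblK.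
Qed.

End BohrFrequencies.

(** * Block encoding from the spectral decomposition *)

Section SpectralEncoding.
Variables (R : realType) (D : nat).
Local Notation C := R[i].

(* In an eigenbasis, the corner [l] of each two-dimensional reflection is
   completed by [- l], except by [1] when [l = 1]: this leaves no vector that is
   orthogonal to the encoding isometry and negated by the reflection. *)
Lemma spectral_block_encoding (Q : 'M[C]_D) :
  Q^t* = Q -> (forall z, eigenvalue Q z -> -1 <= z <= 1) ->
  exists (T : 'M[C]_(D + D, D)) (Rf : 'M[C]_(D + D)),
    block_encoding Q T Rf /\
    forall u : 'cV_(D + D), T^t* *m u = 0 -> Rf *m u = - u -> u = 0.
Proof.
move=> Qh Qitv; have Qherm : Q \is hermsymmx by apply/hermP.
have QE := orthomx_spectralP (hermitian_normalmx Qherm).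
have Pu := spectral_unitarymx Q.
move: (spectralmx Q) (spectral_diag Q) QE Pu => P l QE Pu.
rewrite invmx_unitary // in QE; have PP := unitarymxP Pu.
have PP' : P^t* *m P = 1%:M by rewrite -(mulmx1C PP).
have lR k : exists2 r : R, l 0 k = r%:C & -1 <= r <= 1.
  have : eigenvalue Q (l 0 k).
    apply/eigenvalue_colP; exists (P^t* *m delta_mx k 0).
      apply: contraNneq (oner_neq0 C) => E.
      have := congr1 (mulmx P) E; rewrite mulmxA PP mul1mx mulmx0.
      by move/matrixP/(_ k 0); rewrite !mxE !eqxx => /eqP.
    rewrite QE -!mulmxA (mulmxA P) PP mul1mx scalemxAr; congr (_ *m _).
    apply/matrixP => x y; rewrite mul_diag_mx !mxE !ord1.
    by case: (x =P k) => [->|] //=; rewrite !mulr0.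
  move/Qitv; case: (l 0 k) => x y.
  rewrite !lecE /= => /andP[/andP[/eqP y0 x1] /andP[_ x2]]; exists x.
    by apply/eqP; rewrite eq_complex /= eqxx y0 oppr0 eqxx.
  by rewrite x1 x2.
have [r lE r_itv] : exists2 r : 'I_D -> R, (forall k, l 0 k = (r k)%:C) &
    forall k, -1 <= r k <= 1.
  exists (fun k => complex.Re (l 0 k)) => k; have [x -> //] := lR k.
pose s k := Num.sqrt (1 - r k ^+ 2).
pose r' k := if r k == 1 then 1 else - r k.
pose diagR (f : 'I_D -> R) : 'M[C]_D := diag_mx (\row_k (f k)%:C).
have diagM f g : diagR f *m diagR g = diagR (fun k => f k * g k).
  rewrite mulmx_diag; congr diag_mx; apply/matrixP => x y.
  by rewrite !mxE -rmorphM.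
have diag_adj f : (diagR f)^t* = diagR f.
  rewrite /diagR tr_diag_mx map_diag_mx; congr diag_mx; apply/matrixP => x y.
  by rewrite !mxE; exact: conjc_real.
have diagD f g : diagR f + diagR g = diagR (fun k => f k + g k).
  by rewrite -raddfD; congr diag_mx; apply/matrixP => x y; rewrite !mxE rmorphD.
have diag_eq f g : f =1 g -> diagR f = diagR g.
  by move=> fg; congr diag_mx; apply/matrixP => x y; rewrite !mxE fg.
have diag1 : diagR (fun=> 1) = 1%:M.
  by apply/matrixP => x y; rewrite !mxE.
have diag0 : diagR (fun=> 0) = 0.
  by apply/matrixP => x y; rewrite !mxE mul0rn.
have s_sqr k : s k * s k = 1 - r k ^+ 2.
  rewrite -expr2 sqr_sqrtr // subr_ge0 -[leRHS](expr1n _ 2).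
  by have := r_itv k; rewrite -ler_norml => r1;
    rewrite -real_normK ?num_real // lerXn2r ?nnegrE.
have {}QE : Q = P^t* *m diagR r *m P.
  rewrite QE; suff -> : l = \row_k (r k)%:C by [].
  by apply/matrixP => x y; rewrite mxE ord1 lE.
exists (col_mx P 0), (block_mx (diagR r) (diagR s) (diagR s) (diagR r')).
have Tadj : (col_mx P (0 : 'M[C]_D))^t* = row_mx (P^t*) 0.
  by rewrite tr_col_mx map_row_mx trmx0 map_mx0.
set Rf := block_mx _ _ _ _.
have Rh : Rf^t* = Rf.
  by rewrite /Rf tr_block_mx map_block_mx !diag_adj.
have RR : Rf *m Rf = 1%:M.
  rewrite /Rf mulmx_block !diagM !diagD [RHS]scalar_mx_block -diag1 -diag0.
  (* If [r k = 1] then [s k = 0], so the altered corner keeps the columns orthogonal. *)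
  have rs k : r k * s k + s k * r' k = 0.
    rewrite /r' /s; case: eqP => [->|_]; last by ring.
    by rewrite expr1n subrr sqrtr0 mulr0 mul0r addr0.
  congr block_mx; apply: diag_eq => k; rewrite ?s_sqr.
  - by ring.
  - exact: rs.
  - by rewrite -(rs k); ring.
  - by rewrite /r'; case: eqP => [->|_]; ring.
split.
  split.
  - by rewrite /Defs.isometry Tadj mul_row_col mul0mx addr0.
  - by split; [apply/hermP|apply/unitarymxP; rewrite Rh].
  - rewrite Tadj /Rf mul_row_block !mul0mx !addr0 mul_row_col mulmx0 addr0.
    exact: QE.
move=> u; rewrite -[u]vsubmxK; move: (usubmx u) (dsubmx u) => u1 u2.
rewrite Tadj mul_row_col mul0mx addr0 => Pu1.
have -> : u1 = 0 by rewrite -[u1]mul1mx -PP -mulmxA Pu1 mulmx0.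
rewrite /Rf mul_block_col !mulmx0 !add0r opp_col_mx => /eq_col_mx[_ r'u].
suff -> : u2 = 0 by rewrite col_mx0.
apply/matrixP => k z; move/matrixP/(_ k z): r'u.
(* Being negated means r' u2 = - u2 entrywise, and r' never takes the value -1. *)
rewrite mul_diag_mx !mxE /r'; case: eqP => [_|/eqP r1] /eqP.
  by rewrite rmorph1 mul1r -addr_eq0 -mulr2n mulrn_eq0 => /eqP.
rewrite rmorphN mulNr eqr_opp -subr_eq0 -{2}[u2 k z]mul1r -mulrBl mulf_eq0.
rewrite subr_eq0 -(rmorph1 (real_complex R)) (inj_eq (@complexI _)) (negPf r1) /=.
by move=> /eqP.
Qed.

End SpectralEncoding.

(** * Fixed vectors and phase gap of the walks of the discriminate *)

Section Main.
Variables (R : realType) (d m n : nat) (H : hamiltonian R d m) (beta : R).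
Variables (D : davies H beta n).
Hypothesis d_gt0 : (0 < d)%N.
Hypothesis refl_coupling : forall a, reflection (coupling D a).
Hypothesis filter_le1 : forall a w, w \in bohr H -> filterG D a w <= 1.
Local Notation psi := (gibbs_purif H beta).
Local Notation Delta := (spectral_gap (davies_gen D)).

Lemma discriminate_eig_itv z : eigenvalue (discriminate D) z -> -1 <= z <= 1.
Proof.
have [N [T [Rf be]]] := bohr_block_encoding refl_coupling filter_le1.
exact: (block_encoding_eigen_itv be).
Qed.

Lemma discriminate_walk N (T : 'M[R[i]]_(N, d * d)) Rf :
  block_encoding (discriminate D) T Rf ->
  let W := walk T Rf in
  [/\ W \is unitarymx, W *m (T *m psi) = T *m psi /\ T *m psi != 0,
      unique_stationary (davies_gen D) (gibbs H beta) ->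
        fixes_only_in W (in_walk_space T Rf) (T *m psi)
    & Num.sqrt Delta <= phase_gap W].
Proof.
move=> be; split.
- exact: walk_unitary be.
- split; first exact: (walk_fix be (discriminate_purif D d_gt0)).
  exact: (iso_neq0 be (gibbs_purif_neq0 H beta d_gt0)).
- move=> /(discriminate_fixed d_gt0); exact: fixes_only_in_walk_space.
- exact: (discriminate_phase_gap discriminate_eig_itv be).
Qed.

(** The encoding over Bohr frequencies supplies hermiticity and the spectral bound; these are what
    the spectral encoding requires. *)
Lemma full_walk_encoding :
  exists (N : nat) (T : 'M[R[i]]_(N, d * d)) (Rf : 'M[R[i]]_N),
    block_encoding (discriminate D) T Rf /\
    (unique_stationary (davies_gen D) (gibbs H beta) ->
     fixes_only_in (walk T Rf) (fun _ => True) (T *m psi)).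
Proof.
have [N [T [Rf be]]] := bohr_block_encoding refl_coupling filter_le1.
have Qh := block_encoding_herm be.
have [T' [Rf' [be' orth0]]] := spectral_block_encoding Qh discriminate_eig_itv.
exists _, T', Rf'; split => // /(discriminate_fixed d_gt0).
exact: fixes_only_in_full.
Qed.

End Main.

Theorem theorem12 (R : realType) :
  exists c : R, 0 < c /\
  forall (d m n : nat) (H : hamiltonian R d m) (beta : R) (D : davies H beta n),
    (0 < d)%N ->
    superop_norm (davies_gen D) <= 1 ->
    (forall a, reflection (coupling D a)) ->
    (forall a omega, omega \in bohr H -> filterG D a omega <= 1) ->
    let sigma := gibbs H beta in
    let psi := gibbs_purif H beta in
    let Q := discriminate D in
    let Delta := spectral_gap (davies_gen D) in
    (exists (N : nat) (T : 'M[R[i]]_(N, d * d)) (Rf : 'M[R[i]]_N),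
       let W := walk T Rf in
       [/\ block_encoding Q T Rf,
           W \is unitarymx,
           W *m (T *m psi) = T *m psi /\ T *m psi != 0,
           unique_stationary (davies_gen D) sigma ->
             fixes_only_in W (fun _ => True) (T *m psi)
         & c * Num.sqrt Delta <= phase_gap W]) /\
    (forall P : pointer H,
     exists (a : nat) (T : 'M[R[i]]_(d * d * (#|P| * a), d * d))
            (Rf : 'M[R[i]]_(d * d * (#|P| * a))),
       let W := walk T Rf in
       [/\ block_encoding Q T Rf,
           implementable_block_encoding D T Rf,
           W \is unitarymx /\
             (W *m (T *m psi) = T *m psi /\ T *m psi != 0),
           unique_stationary (davies_gen D) sigma ->
             fixes_only_in W (in_walk_space T Rf) (T *m psi)
         & c * Num.sqrt Delta <= phase_gap W]).
Proof.
(* The quadratic cosine bound gives theta^2 >= 2 Delta, so the constant 1 suffices. *)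
exists 1; split; first exact: ltr01.
move=> d m n H beta D d_gt0 _ refl le1 /=; rewrite mul1r; split.
  have [N [T [Rf [be full]]]] := full_walk_encoding d_gt0 refl le1.
  have [Wu Wpsi _ gap] := discriminate_walk d_gt0 refl le1 be.
  by exists N, T, Rf; split.
move=> P; have [T [Rf [be im]]] := pointer_block_encoding P refl le1.
have [Wu Wpsi uniq gap] := discriminate_walk d_gt0 refl le1 be.
by exists _, T, Rf; split.
Qed.
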